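(* Let $L:\mathbb{R}^D\to\mathbb{R}$ be $\mathcal{C}^4$ and let $\Gamma\subset\mathbb{R}^D$ be a $\mathcal{C}^2$ submanifold of dimension $D-M$, for some integer $1\le M\le D$, such that every $x\in\Gamma$ is a local minimizer of $L$ and $\mathrm{rank}(\nabla^2L(x))=M$. Then the ascent-direction sharpness $$R^{\mathrm{Asc}}_\rho(x)=L\Bigl(x+\rho\frac{\nabla L(x)}{\|\nabla L(x)\|_2}\Bigr)-L(x)\ \text{ if }\nabla L(x)\neq0,\qquad R^{\mathrm{Asc}}_\rho(x)=\infty\ \text{ if }\nabla L(x)=0,$$ admits $\lambda_M(\nabla^2L(\cdot))/2$ as a good limiting regularizer on $\Gamma$. Moreover it is mildly bounded below: for any bounded closed set $B\subset U$ there exists $C>0$ such that for all sufficiently small $\rho>0$ and all $x\in B$, $R^{\mathrm{Asc}}_\rho(x)\ge-C\rho^2$. Here $U$ is the attraction set of $\Gamma$.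
   Context: $\lambda_1(A)\ge\dots\ge\lambda_D(A)$ are the eigenvalues of a symmetric matrix $A\in\mathbb{R}^{D\times D}$. Gradient flow: $\phi(x,\tau)=x-\int_0^\tau\nabla L(\phi(x,t))\,dt$, $\Phi(x)=\lim_{\tau\to\infty}\phi(x,\tau)$ when it exists; $U=\{x:\Phi(x)\text{ exists and }\Phi(x)\in\Gamma\}$. For a family of functions $R_\rho:\mathbb{R}^D\to\mathbb{R}\cup\{\infty\}$, $\rho>0$, the limiting regularizer is $S:\Gamma\to\mathbb{R}$, $S(x)=\lim_{\rho\to0}\lim_{r\to0}\inf_{\|x'-x\|_2\le r}R_\rho(x')/\rho^2$. The limiting regularizer $S$ is good around $x^*\in\Gamma$ if $S$ is non-negative and continuous at $x^*$ and there is an open set $V_{x^*}\ni x^*$ such that for any $C,\epsilon>0$ there is $\rho_{x^*}>0$ with $\bigl|S(x)-\inf_{\|x'-x\|_2\le C\rho}R_\rho(x')/\rho^2\bigr|<\epsilon$ for all $x\in\Gamma\cap V_{x^*}$ and all $0<\rho\le\rho_{x^*}$. $\{R_\rho\}$ admits $S$ as a good limiting regularizer on $\Gamma$ if $S$ is its limiting regularizer and is good around every point of $\Gamma$. *)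

(* Defs.v *)
From HB Require Import structures.
From mathcomp Require Import all_boot all_order all_algebra.
From mathcomp Require Import all_classical all_reals all_analysis.
From mathcomp Require Import polyrcf.

Set Implicit Arguments.
Unset Strict Implicit.
Unset Printing Implicit Defensive.

Import Order.TTheory GRing.Theory Num.Theory.
Import numFieldNormedType.Exports.

Local Open Scope classical_set_scope.
Local Open Scope ring_scope.

(* Vectors of R^D are row vectors 'rV[R]_D.  The library norm `|x| on 'rV[R]_D
   is the sup norm; it defines the usual topology, but every length below is
   measured with the Euclidean norm l2norm. *)
Definition l2norm (R : realType) (D : nat) (x : 'rV[R]_D) : R :=
  Num.sqrt (\sum_(i < D) x 0 i ^+ 2).

(* C^k functions on an open set A; on a finite-dimensional V the continuity of
   all the iterated directional derivatives is continuity of the iterated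
   differentials. *)
Fixpoint Ck_on (R : realType) (V W : normedModType R) (k : nat) (A : set V)
    (f : V -> W) {struct k} : Prop :=
  match k with
  | 0 => forall x, A x -> {for x, continuous f}
  | k'.+1 => (forall x, A x -> differentiable f x) /\
             (forall v : V, Ck_on k' A ('D_v f))
  end.

Definition grad (R : realType) (D : nat) (L : 'rV[R]_D -> R) (x : 'rV[R]_D) :
    'rV[R]_D :=
  \row_(i < D) 'D_(delta_mx 0 i) L x.

Definition hessian (R : realType) (D : nat) (L : 'rV[R]_D -> R)
    (x : 'rV[R]_D) : 'M[R]_D :=
  \matrix_(i < D, j < D) 'D_(delta_mx 0 i) ('D_(delta_mx 0 j) L) x.

(* The real eigenvalues of A in nonincreasing order, repeated according to
   their multiplicity in the characteristic polynomial.  If A is symmetric the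
   list has length n. *)
Definition eigenvalues (R : realType) (n : nat) (A : 'M[R]_n) : seq R :=
  let p := char_poly A in
  sort (fun a b : R => b <= a) (flatten [seq nseq (mup a p) a | a <- rootsR p]).

(* lambda_1 >= ... >= lambda_n: k is counted from 1. *)
Definition lambda (R : realType) (n : nat) (k : nat) (A : 'M[R]_n) : R :=
  nth 0 (eigenvalues A) k.-1.

(* Embedded m-dimensional C^k submanifold of R^D: around each of its points a
   C^k diffeomorphism phi (with inverse psi) between open sets maps Gamma onto
   the slice R^m x {0}. *)
Definition submanifold (R : realType) (D k m : nat) (Gamma : set 'rV[R]_D) :
    Prop :=
  forall p, Gamma p ->
  exists (A B : set 'rV[R]_D) (phi psi : 'rV[R]_D -> 'rV[R]_D),
    [/\ [/\ open A, A p & open B],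
        [/\ Ck_on k A phi, Ck_on k B psi, phi @` A `<=` B & psi @` B `<=` A],
        (forall x, A x -> psi (phi x) = x) /\
        (forall y, B y -> phi (psi y) = y) &
        forall x, A x ->
          (Gamma x <-> forall i : 'I_D, (m <= i)%N -> phi x 0 i = 0)].

Definition local_minimizer (R : realType) (D : nat) (L : 'rV[R]_D -> R)
    (x : 'rV[R]_D) : Prop :=
  \forall y \near x, L x <= L y.

(* phi is the gradient flow of L started at x, defined for all times t >= 0. *)
Definition gradient_flow (R : realType) (D : nat) (L : 'rV[R]_D -> R)
    (x : 'rV[R]_D) (phi : R -> 'rV[R]_D) : Prop :=
  {within `[0, +oo[, continuous phi} /\
  forall tau : R, 0 <= tau ->
    phi tau = x - \row_(i < D)
      (\int[lebesgue_measure]_(t in `[0, tau]) (grad L (phi t) 0 i)).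

(* Phi(x) exists and is equal to p. *)
Definition flow_limit (R : realType) (D : nat) (L : 'rV[R]_D -> R)
    (x p : 'rV[R]_D) : Prop :=
  exists2 phi : R -> 'rV[R]_D,
    gradient_flow L x phi & phi tau @[tau --> +oo] --> p.

Definition attraction_set (R : realType) (D : nat) (L : 'rV[R]_D -> R)
    (Gamma : set 'rV[R]_D) : set 'rV[R]_D :=
  [set x | exists2 p, Gamma p & flow_limit L x p].

(* inf of Reg_rho(x') / rho^2 over the closed Euclidean ball of radius r. *)
Definition ball_inf (R : realType) (D : nat)
    (Reg : R -> 'rV[R]_D -> \bar R) (rho : R) (x : 'rV[R]_D) (r : R) : \bar R :=
  ereal_inf [set (Reg rho x' * (rho ^- 2)%:E)%E
            | x' in [set x' | l2norm (x' - x) <= r]].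

(* S and Reg are total functions of which only the values S x for x in Gamma
   and Reg rho for rho > 0 matter; g rho is the inner limit, in \bar R. *)
Definition limiting_regularizer (R : realType) (D : nat)
    (Reg : R -> 'rV[R]_D -> \bar R) (Gamma : set 'rV[R]_D)
    (S : 'rV[R]_D -> R) : Prop :=
  forall x, Gamma x ->
  exists2 g : R -> \bar R,
    forall rho : R, 0 < rho -> ball_inf Reg rho x r @[r --> 0^'+] --> g rho &
    g rho @[rho --> 0^'+] --> (S x)%:E.

Definition good_around (R : realType) (D : nat)
    (Reg : R -> 'rV[R]_D -> \bar R) (Gamma : set 'rV[R]_D)
    (S : 'rV[R]_D -> R) (xs : 'rV[R]_D) : Prop :=
  [/\ 0 <= S xs,
      S x @[x --> within Gamma (nbhs xs)] --> S xs &
      exists V : set 'rV[R]_D,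
        [/\ open V, V xs &
            forall C eps : R, 0 < C -> 0 < eps ->
            exists2 rhos : R, 0 < rhos &
              forall x rho, Gamma x -> V x -> 0 < rho -> rho <= rhos ->
                (`| (S x)%:E - ball_inf Reg rho x (C * rho) | < eps%:E)%E]].

Definition good_limiting_regularizer (R : realType) (D : nat)
    (Reg : R -> 'rV[R]_D -> \bar R) (Gamma : set 'rV[R]_D)
    (S : 'rV[R]_D -> R) : Prop :=
  limiting_regularizer Reg Gamma S /\
  forall xs, Gamma xs -> good_around Reg Gamma S xs.

Definition asc_sharpness (R : realType) (D : nat) (L : 'rV[R]_D -> R)
    (rho : R) (x : 'rV[R]_D) : \bar R :=
  if grad L x == 0 then +oo%E
  else (L (x + rho *: ((l2norm (grad L x))^-1 *: grad L x)) - L x)%:E.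

Definition mildly_bounded_below (R : realType) (D : nat)
    (Reg : R -> 'rV[R]_D -> \bar R) (U : set 'rV[R]_D) : Prop :=
  forall B : set 'rV[R]_D, bounded_set B -> closed B -> B `<=` U ->
  exists2 C : R, 0 < C &
    \forall rho \near 0^'+,
      forall x, B x -> ((- (C * rho ^+ 2))%:E <= Reg rho x)%E.

(* Main.v *)
Require Import Defs.
From mathcomp Require Import all_boot all_order all_algebra.
From mathcomp Require Import all_classical all_reals all_analysis.
From mathcomp Require Import sesquilinear spectral polyrcf complex.
From mathcomp Require Import ring lra.

Set Implicit Arguments.
Unset Strict Implicit.
Unset Printing Implicit Defensive.

Import Order.TTheory GRing.Theory Num.Theory.
Import numFieldNormedType.Exports.

Local Open Scope classical_set_scope.
Local Open Scope ring_scope.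

(* Near a point p of Gamma, write x = psi z in a chart flattening Gamma and let
   w be the normal part of z.  The rank hypothesis makes the derivative N of
   z |-> grad L (psi z) at p injective on normal vectors, so the mean value
   theorem gives grad L x = w N + o(|w N|), where w N is in the range of the
   Hessian H p.  On this range the Rayleigh quotient of H p is at least
   lambda_M, the least nonzero eigenvalue, so the second-order Taylor expansion
   along the ascent direction bounds the sharpness below by
   (lambda_M - eps) rho^2 / 2, the first-order term being nonnegative.  For the
   upper bound approach x in Gamma along an eigenvector v of lambda_M: the
   ascent direction at x + t v tends to v as t -> 0+.  Courant-Fischer makes
   lambda_M continuous on Gamma, and compactness makes these local estimates
   uniform.  The bound from below by -C rho^2 needs only the Taylor expansion
   and the boundedness of the Hessian on bounded sets. *)

(** * Spectral theory of symmetric matrices *)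

(** The rows of [E] are the basis vectors indexed by the nonzero entries of [d]. As [E *m E^T = 1],
    [diag_mx d] and the invertible [D'] each factor through the other, so their ranks agree. *)
Lemma mxrank_diag (F : fieldType) n (d : 'rV[F]_n) :
  \rank (diag_mx d) = #|[pred i | d 0 i != 0]|.
Proof.
set S := [pred i | _].
pose f (k : 'I_#|S|) : 'I_n := enum_val k.
pose E := \matrix_(k, j) ((f k == j)%:R : F).
pose D' := diag_mx (\row_k d 0 (f k)).
have fI : injective f := @enum_val_inj _ _.
have EET : E *m E^T = 1%:M.
  apply/matrixP => i j; rewrite !mxE (bigD1 (f i)) //= big1 ?addr0.
    by rewrite !mxE eqxx mul1r eq_sym (inj_eq fI).
  by move=> k ki; rewrite !mxE eq_sym (negPf ki) mul0r.
have dE : diag_mx d = E^T *m D' *m E.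
  apply/matrixP => i j; rewrite !mxE.
  have [Si|] := boolP (i \in S); last first.
    rewrite inE negbK => /eqP di0; rewrite di0 mul0rn big1 // => k _.
    rewrite !mxE big1 ?mul0r // => l _; rewrite !mxE.
    have [fl|_] := eqVneq (f l) i; last by rewrite mul0r.
    by rewrite fl di0 mul0rn mulr0.
  have [k0 fi] : exists k0, f k0 = i.
    by exists (enum_rank_in Si i); rewrite /f enum_rankK_in.
  rewrite (bigD1 k0) //= big1 ?addr0; last first.
    move=> k kk0; rewrite !mxE big1 ?mul0r // => l _; rewrite !mxE -fi (inj_eq fI).
    have [->|_] := eqVneq l k0; last by rewrite mul0r.
    by rewrite eq_sym (negPf kk0) mulr0.
  rewrite !mxE (bigD1 k0) //= big1 ?addr0; last first.
    by move=> l lk0; rewrite !mxE -fi (inj_eq fI) (negPf lk0) mul0r.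
  by rewrite !mxE fi !eqxx mul1r mulr1n mulr_natr.
have D'u : D' \in unitmx.
  rewrite unitmxE det_diag unitfE; apply/prodf_neq0 => k _.
  by rewrite mxE; have := enum_valP k; rewrite inE.
apply/eqP; rewrite eqn_leq; apply/andP; split.
  by rewrite dE; apply: leq_trans (mxrankM_maxr _ _) (rank_leq_row _).
have {1}<- : \rank D' = #|S| by apply: mxrank_unit.
have -> : D' = E *m diag_mx d *m E^T.
  by rewrite dE !mulmxA EET mul1mx -!mulmxA EET mulmx1.
by apply: leq_trans (mxrankM_maxl _ _) (mxrankM_maxr _ _).
Qed.

Lemma mup_prod_XsubC (F : fieldType) (s : seq F) a :
  mup a (\prod_(b <- s) ('X - b%:P)) = count_mem a s.
Proof.
elim: s => [|b s IH]; first by rewrite big_nil mupNroot // root1.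
rewrite big_cons mupM ?polyXsubC_eq0 ?monic_neq0 ?monic_prod_XsubC //= IH.
by rewrite -['X - b%:P]expr1 mup_XsubCX eq_sym; case: eqP.
Qed.

Lemma char_poly_conj (F : fieldType) n (P D : 'M[F]_n) : P \in unitmx ->
  char_poly (invmx P *m D *m P) = char_poly D.
Proof.
move=> Pu; pose cP := map_mx (@polyC F) P; pose cV := map_mx (@polyC F) (invmx P).
have VP : cV *m cP = 1%:M by rewrite -map_mxM mulVmx // map_mx1.
have -> : char_poly (invmx P *m D *m P) = \det (cV *m char_poly_mx D *m cP).
  congr (\det _); rewrite /char_poly_mx !map_mxM mulmxBr mulmxBl.
  by rewrite (scalar_mxC _ cV) -(mulmxA _ cV) VP mulmx1.
by rewrite !det_mulmx mulrAC -det_mulmx VP det1 mul1r.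
Qed.

Section Spectral.
Variable R : realType.

Definition dotp n (u v : 'rV[R]_n) : R := (u *m v^T) 0 0.

Lemma dotpE n (u v : 'rV[R]_n) : dotp u v = \sum_i u 0 i * v 0 i.
Proof. by rewrite /dotp mxE; apply: eq_bigr => i _; rewrite mxE. Qed.

Lemma dotpC n (u v : 'rV[R]_n) : dotp u v = dotp v u.
Proof. by rewrite !dotpE; apply: eq_bigr => i _; rewrite mulrC. Qed.

Lemma dotpDl n (u v w : 'rV[R]_n) : dotp (u + v) w = dotp u w + dotp v w.
Proof. by rewrite /dotp mulmxDl mxE. Qed.

Lemma dotpDr n (u v w : 'rV[R]_n) : dotp w (u + v) = dotp w u + dotp w v.
Proof. by rewrite dotpC dotpDl !(dotpC w). Qed.

Lemma dotpZl n a (u w : 'rV[R]_n) : dotp (a *: u) w = a * dotp u w.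
Proof. by rewrite /dotp -scalemxAl mxE. Qed.

Lemma dotpZr n a (u w : 'rV[R]_n) : dotp w (a *: u) = a * dotp w u.
Proof. by rewrite dotpC dotpZl dotpC. Qed.

Lemma dotpBl n (u v w : 'rV[R]_n) : dotp (u - v) w = dotp u w - dotp v w.
Proof. by rewrite -scaleN1r dotpDl dotpZl mulN1r. Qed.

Lemma dotp0l n (u : 'rV[R]_n) : dotp 0 u = 0.
Proof. by rewrite /dotp mul0mx mxE. Qed.

Lemma dotp_ge0 n (u : 'rV[R]_n) : 0 <= dotp u u.
Proof. by rewrite dotpE; apply: sumr_ge0 => i _; rewrite -expr2 sqr_ge0. Qed.

Lemma dotp_eq0 n (u : 'rV[R]_n) : (dotp u u == 0) = (u == 0).
Proof.
apply/idP/eqP => [|->]; last by rewrite dotp0l.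
rewrite dotpE psumr_eq0; last by move=> i _; rewrite -expr2 sqr_ge0.
move=> /allP u0; apply/rowP => i; rewrite mxE.
by have := u0 i (mem_index_enum _); rewrite /= mulf_eq0 orbb => /eqP.
Qed.

Lemma dotp_gt0 n (u : 'rV[R]_n) : (0 < dotp u u) = (u != 0).
Proof. by rewrite lt_def dotp_eq0 dotp_ge0 andbT. Qed.

Lemma dotp_sym n (A : 'M[R]_n) u v : A^T = A ->
  dotp (u *m A) v = dotp u (v *m A).
Proof. by move=> sA; rewrite /dotp trmx_mul sA mulmxA. Qed.

Local Notation toC := (real_complex R).
Local Notation C := (complex R).

(** Over the complex numbers a real symmetric matrix is Hermitian, hence unitarily diagonalizable
    with real eigenvalues; only the change of basis [P] may have complex entries. *)
Lemma sym_spectral n (A : 'M[R]_n) : A^T = A ->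
  exists (P : 'M[C]_n) (d : 'rV[R]_n), P \is unitarymx /\
    map_mx toC A = invmx P *m diag_mx (map_mx toC d) *m P.
Proof.
move=> sA; set AC := map_mx toC A.
have hA : AC \is hermsymmx.
  apply: realsym_hermsym.
    by apply/is_hermitianmxP; rewrite expr0 scale1r map_mx_id // map_trmx sA.
  apply/mxOverP => i j; rewrite mxE; apply/CrealP.
  by rewrite /Num.conj /= /complex.conjc /= oppr0.
have sr := hermitian_spectral_diag_real hA.
exists (spectralmx AC), (map_mx (fun z : C => complex.Re z) (spectral_diag AC)).
split; first exact: spectral_unitarymx.
have /orthomx_spectralP {1}-> := hermitian_normalmx hA.
congr (_ *m diag_mx _ *m _); apply/rowP => i; rewrite !mxE.
move/mxOverP/(_ 0 i)/CrealP: sr; case: (spectral_diag AC 0 i) => a b.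
rewrite /Num.conj /= /complex.conjc /= => -[] bE.
by congr (complex.Complex _ _); lra.
Qed.

Lemma sym_char_poly n (A : 'M[R]_n) (P : 'M[C]_n) (d : 'rV[R]_n) : P \is unitarymx ->
  map_mx toC A = invmx P *m diag_mx (map_mx toC d) *m P ->
  char_poly A = \prod_(a <- [seq d 0 i | i <- enum 'I_n]) ('X - a%:P).
Proof.
move=> uP AE; have iP := unitarymx_unit uP.
apply: (@map_poly_inj _ _ toC); rewrite map_char_poly AE.
rewrite char_poly_conj //.
rewrite char_poly_trig ?diag_mx_is_trig // big_map rmorph_prod /= big_enum /=.
by apply: eq_bigr => i _; rewrite !mxE eqxx mulr1n map_polyXsubC.
Qed.

Lemma sorted_eigenvalues n (A : 'M[R]_n) : sorted >=%R (eigenvalues A).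
Proof. by apply: sort_sorted => a b; apply: le_total. Qed.

(** The occurrences of each [a] are counted: among the distinct roots only the block of [a]
    contributes, and its length is the multiplicity of [a] in the product over [s]. *)
Lemma perm_eigenvalues n (A : 'M[R]_n) (s : seq R) :
  char_poly A = \prod_(a <- s) ('X - a%:P) -> perm_eq (eigenvalues A) s.
Proof.
move=> cA; have p0 : char_poly A != 0 by rewrite monic_neq0 ?char_poly_monic.
rewrite /eigenvalues perm_sort; apply/allP => a _ /=; apply/eqP.
rewrite count_flatten -map_comp sumnE big_map.
have uR : uniq (rootsR (char_poly A)) by exact: uniq_roots.
under eq_bigr => b _ do rewrite /= count_nseq /= eq_sym.
have aR : (a \in rootsR (char_poly A)) = (a \in s).
  have /(_ a) := roots_on_rootsR p0; rewrite in_itv /= => <-.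
  by rewrite cA root_prod_XsubC.
have [aS|aS] := boolP (a \in s); last first.
  rewrite -aR in aS; rewrite big_seq big1 => [|b bR].
    by apply/esym/count_memPn; rewrite -aR.
  by case: eqP => [ba|//]; move: aS; rewrite ba bR.
rewrite (bigD1_seq a) ?aR //= big1 ?addn0; last first.
  by move=> b ba; rewrite eq_sym (negPf ba).
by rewrite eqxx mul1n cA mup_prod_XsubC.
Qed.
(** A nonincreasing list of nonnegative numbers consists of its nonzero entries followed by zeros,
    so [M.-1], counted from 0, is the index of the last nonzero entry. *)
Lemma nth_sorted_pos (s : seq R) M : sorted >=%R s -> all (>= 0) s ->
  count (fun a => a != 0) s = M -> (0 < M)%N ->
  [/\ nth 0 s M.-1 \in s, 0 < nth 0 s M.-1 &
      forall a, a \in s -> a != 0 -> nth 0 s M.-1 <= a].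
Proof.
move=> ss s0 cM M0; set p := fun a : R => a != 0.
have tr : transitive (>=%R : rel R) by move=> a b c ab bc; apply: le_trans bc ab.
have as_ : antisymmetric (>=%R : rel R).
  by move=> a b /andP[ab ba]; apply: le_anti; apply/andP; split; [exact: ba|exact: ab].
have sE : s = seq.filter p s ++ seq.filter (predC p) s.
  apply: (sorted_eq tr as_ ss); last by rewrite perm_sym perm_filterC.
  have sf q : sorted >=%R (seq.filter q s) by apply: sorted_filter.
  rewrite sorted_pairwise // pairwise_cat -!sorted_pairwise // !sf !andbT.
  apply/allrelP => a b; rewrite !mem_filter /p /= negbK => /andP[_ aS] /andP[/eqP-> _].
  exact: (allP s0).
have sz : size (seq.filter p s) = M by rewrite size_filter.
have ltM : (M.-1 < size (seq.filter p s))%N by rewrite sz prednK.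
have nE : nth 0 s M.-1 = nth 0 (seq.filter p s) M.-1 by rewrite {1}sE nth_cat ltM.
have := mem_nth 0 ltM; rewrite -nE mem_filter => /andP[n0 nS].
split=> //; first by rewrite lt_def (allP s0 _ nS) andbT; exact: n0.
move=> a aS a0; have : a \in seq.filter p s by rewrite mem_filter /p a0.
move=> /(nthP 0)[i iM <-]; rewrite nE.
have sf : sorted >=%R (seq.filter p s) by apply: sorted_filter.
have := sorted_leq_nth tr (fun x => lexx x) 0 sf; apply; rewrite ?inE //.
by rewrite -ltnS prednK // -sz.
Qed.

(** In the coordinates [y] of [u] in the eigenbasis, the form is the sum of the $e_i |y_i|^2$. *)
Lemma quad_conj_ge0 n (K : 'M[R]_n) (P : 'M[C]_n) (e u : 'rV[R]_n) :
  (map_mx toC K = map_mx Num.conj P^T *m diag_mx (map_mx toC e) *m P) ->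
  (forall i, 0 <= e 0 i) -> 0 <= dotp (u *m K) u.
Proof.
move=> KE e0; rewrite -lecR /dotp.
set y := map_mx toC u *m map_mx Num.conj P^T.
have -> : ((u *m K *m u^T) 0 0)%:C%C =
    (y *m diag_mx (map_mx toC e) *m map_mx Num.conj y^T) 0 0.
  have -> : ((u *m K *m u^T) 0 0)%:C%C = (map_mx toC (u *m K *m u^T)) 0 0.
    by rewrite [RHS]mxE.
  have conjP : map_mx Num.conj (map_mx Num.conj P^T)^T = P.
    by apply/matrixP => i j; rewrite !mxE conjCK.
  have conju : map_mx Num.conj (map_mx toC u)^T = map_mx toC u^T.
    apply/matrixP => i j; rewrite !mxE.
    by rewrite /Num.conj /= /complex.conjc /= oppr0.
  by rewrite !map_mxM KE /y trmx_mul map_mxM conjP conju !mulmxA.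
rewrite mul_mx_diag mxE; apply: sumr_ge0 => i _; rewrite !mxE.
rewrite mulrAC -normCK mulr_ge0 ?exprn_ge0 //.
by rewrite -[0]/(0%:C%C) lecR.
Qed.

(** There are exactly [M] nonzero eigenvalues, all positive, so [lambda M A] is the least of them.
    The last clause is the Rayleigh bound on the range of [A], whose vectors are written
    [u *m A]. *)
Lemma lambda_spec n (M : nat) (A : 'M[R]_n) : A^T = A ->
  (forall u : 'rV[R]_n, 0 <= dotp (u *m A) u) -> \rank A = M -> (0 < M)%N ->
  [/\ 0 < lambda M A,
      exists2 v : 'rV[R]_n, v != 0 & v *m A = lambda M A *: v &
      forall u : 'rV[R]_n, lambda M A * dotp (u *m A) (u *m A) <=
                dotp (u *m A *m A) (u *m A)].
Proof.
move=> sA psdA rA M0.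
have [P [d [uP AE]]] := sym_spectral sA.
have iP := unitarymx_unit uP.
have cA := sym_char_poly uP AE.
have pe := perm_eigenvalues cA; set s := [seq _ | _ <- _] in cA pe.
have eigE a : (a \in eigenvalues A) = eigenvalue A a.
  by rewrite (perm_mem pe) eigenvalue_root_char cA root_prod_XsubC.
have ev a : a \in eigenvalues A -> exists2 v : 'rV[R]_n, v != 0 & v *m A = a *: v.
  by rewrite eigE => /eigenvalueP[v vA v0]; exists v.
have s0 : all (>= 0) (eigenvalues A).
  apply/allP => a /ev[v v0 vA]; have := psdA v.
  by rewrite vA dotpZl pmulr_lge0 // dotp_gt0.
have cM : count (fun a => a != 0) (eigenvalues A) = M.
  rewrite (permP pe) /s count_map -rA.
  rewrite -(mxrank_map toC) AE mxrankMfree ?row_free_unit //.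
  rewrite -mxrank_tr trmx_mul mxrankMfree ?row_free_unit ?unitmx_tr ?unitmx_inv //.
  rewrite tr_diag_mx mxrank_diag cardE -size_filter enumT /enum_mem; congr size.
  by rewrite -enumT; apply: eq_filter => i; rewrite !inE /= mxE -(inj_eq (@complexI R)).
have [l1 l2 l3] := nth_sorted_pos (sorted_eigenvalues A) s0 cM M0.
split; [exact: l2|exact: ev|move=> u].
rewrite -subr_ge0 -/(lambda M A); set l := lambda M A.
(* It suffices that [K] is positive semidefinite: its eigenvalues are $d^2 (d - l)$, and each
   eigenvalue $d$ of [A] is either 0 or at least [l]. *)
pose K := A *m A *m A - l *: (A *m A).
have -> : dotp (u *m A *m A) (u *m A) - l * dotp (u *m A) (u *m A) = dotp (u *m K) u.
  rewrite -2!(dotp_sym _ u sA) -dotpZl -dotpBl /K; congr dotp.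
  by rewrite mulmxBr -scalemxAr !mulmxA.
pose e : 'rV[R]_n := \row_i (d 0 i ^+ 3 - l * d 0 i ^+ 2).
apply: (@quad_conj_ge0 _ _ P e) => [|i]; last first.
  rewrite mxE exprS -mulrBl; have dS : d 0 i \in eigenvalues A.
    by rewrite (perm_mem pe); apply: map_f; rewrite mem_enum.
  have [->|di0] := eqVneq (d 0 i) 0; first by rewrite expr0n mulr0.
  by rewrite mulr_ge0 ?sqr_ge0 // subr_ge0 l3.
rewrite -(invmx_unitary uP) /K map_mxB map_mxZ !map_mxM AE.
rewrite !mulmxA !(mulmxK iP).
set D := diag_mx _.
have -> : diag_mx (map_mx toC e) = D *m D *m D - l%:C%C *: (D *m D).
  rewrite /D !mulmx_diag; apply/matrixP => i j; rewrite !mxE.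
  rewrite rmorphB rmorphXn (rmorphM _ l) rmorphXn /=.
  case: (i == j); rewrite ?mulr1n ?mulr0n; last by rewrite mulr0 subr0.
  by rewrite !exprS expr0 mulr1 !mulrA.
by rewrite mulmxBr mulmxBl -scalemxAr -scalemxAl !mulmxA.
Qed.

(** Courant-Fischer argument: the range of [A], of dimension [M], meets the kernel of [B] enlarged
    by an eigenvector for [lambda M B], a space of dimension greater than [n - M]. A common nonzero
    vector has Rayleigh quotient at least [lambda M A] for [A] and at most [lambda M B] for [B]. *)
Lemma lambda_le_add n (M : nat) (A B : 'M[R]_n) eps :
  A^T = A -> (forall u : 'rV[R]_n, 0 <= dotp (u *m A) u) -> \rank A = M ->
  B^T = B -> (forall u : 'rV[R]_n, 0 <= dotp (u *m B) u) -> \rank B = M ->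
  (0 < M)%N ->
  (forall w : 'rV[R]_n, dotp (w *m A) w <= dotp (w *m B) w + eps * dotp w w) ->
  lambda M A <= lambda M B + eps.
Proof.
move=> sA pA rA sB pB rB M0 AB.
have [la _ lA] := lambda_spec sA pA rA M0.
have [lb [v v0 vB] _] := lambda_spec sB pB rB M0.
set S := (kermx B + v)%MS.
have vker : ~~ (v <= kermx B)%MS.
  by apply/sub_kermxP; rewrite vB => /eqP; rewrite scaler_eq0 (negPf v0) gt_eqF.
have rS : (n - M < \rank S)%N.
  rewrite -rB -mxrank_ker; apply: rank_ltmx; rewrite ltmxE addsmxSl.
  by apply: contra vker; apply: submx_trans; apply: addsmxSr.
have : (A :&: S)%MS != 0.
  rewrite -mxrank_eq0 -lt0n -(ltn_add2l (\rank (A + S)%MS)) addn0 mxrank_sum_cap rA.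
  apply: leq_ltn_trans (rank_leq_col _) _; have := rank_leq_col A; rewrite rA => Mn.
  by rewrite -{1}(subnKC Mn) ltn_add2l.
case/rowV0Pn => w; rewrite sub_capmx.
move=> /andP[/submxP[u wA] /sub_addsmxP[[k c] /= wS]] w0.
have cv : c *m v = c 0 0 *: v by rewrite [c]mx11_scalar mul_scalar_mx !mxE eqxx mulr1n.
rewrite {}cv in wS; set k' := k *m kermx B in wS; set a := c 0 0 in wS.
have kB : k' *m B = 0 by rewrite /k' -mulmxA mulmx_ker mulmx0.
(* The eigenspaces for the distinct eigenvalues [lambda M B] and 0 are orthogonal. *)
have vk : dotp v k' = 0.
  apply: (mulfI (lt0r_neq0 lb)).
  by rewrite -dotpZl -vB dotp_sym // kB dotpC dotp0l mulr0.
have wB : dotp (w *m B) w <= lambda M B * dotp w w.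
  rewrite wS mulmxDl kB add0r -scalemxAl vB !dotpDl !dotpDr !dotpZl !dotpZr.
  rewrite (dotpC k' v) vk.
  have := mulr_ge0 (ltW lb) (dotp_ge0 k'); nra.
have := lA u; rewrite -wA => le1.
have := AB w => le2; have w1 : 0 < dotp w w by rewrite dotp_gt0.
rewrite -(ler_pM2r w1) mulrDl; lra.
Qed.
End Spectral.

(** * Second-order calculus *)

Section Calculus.
Variable R : realType.

Lemma is_derive_line (V W : normedModType R) (f : V -> W) (x v : V) (t : R) :
  differentiable f (x + t *: v) ->
  is_derive t 1 (fun s : R => f (x + s *: v)) ('D_v f (x + t *: v)).
Proof.
move=> df.
have dl : is_diff t (fun s : R => x + s *: v) (fun s : R => s *: v).
  have -> : (fun s : R => x + s *: v) = cst x + *:%R^~ v by apply/funext.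
  by apply: is_diff_eq; rewrite add0r.
case: dl => dl dlE.
have dc : differentiable (f \o (fun s : R => x + s *: v)) t.
  exact: differentiable_comp.
apply: DeriveDef; first exact: diff_derivable dc.
by rewrite deriveE // diff_comp //= dlE scale1r deriveE.
Qed.

(** The mean value theorem is used twice: on [h1], and then on [g], which is [h] minus its linear
    and quadratic terms and whose derivative is nonnegative by the first use. *)
Lemma ge_taylor2 (h h1 h2 : R -> R) (c r : R) :
  (forall t : R, is_derive t 1 h (h1 t)) -> (forall t : R, is_derive t 1 h1 (h2 t)) ->
  0 <= r -> (forall t, 0 <= t <= r -> c <= h2 t) ->
  h 0 + h1 0 * r + c * r ^+ 2 / 2 <= h r.
Proof.
move=> dh dh1 r0 ch2.
have cont (f g : R -> R) A :
    (forall t : R, is_derive t 1 f (g t)) -> {within A, continuous f}.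
  move=> df; apply: continuous_subspaceT => t.
  by apply: differentiable_continuous; apply/derivable1_diffP; exact: ex_derive.
have h1_ge t : 0 <= t <= r -> h1 0 + c * t <= h1 t.
  move=> /andP[t0 tr].
  have [s] := MVT_segment t0 (fun s _ => dh1 s) (cont _ _ _ dh1).
  rewrite in_itv /= subr0 => /andP[s0 st] e.
  rewrite -lerBrDl e ler_wpM2r // ch2 // s0 //=; exact: le_trans tr.
pose g t := h t - (h1 0 * t + c / 2 * t ^+ 2).
have dg (t : R) : is_derive t 1 g (h1 t - (h1 0 + c * t)).
  have -> : g = h - ((fun t => h1 0 * t) + (fun t => c / 2 * t ^+ 2)) by apply/funext.
  apply: is_deriveB; apply: is_deriveD.
    by apply: is_derive_eq; rewrite /GRing.scale /=; ring.
  by apply: is_derive_eq; rewrite /GRing.scale /=; field.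
have [s] := MVT_segment r0 (fun s _ => dg s) (cont _ _ _ dg).
rewrite in_itv /= subr0 => sr e.
have : 0 <= g r - g 0 by rewrite e mulr_ge0 // subr_ge0 h1_ge.
by rewrite /g expr0n /=; lra.
Qed.

(** * Functions of class C^2: symmetry of the Hessian, Taylor bounds, conditions at a minimizer *)

Section C2.
Variables (D : nat) (L : 'rV[R]_D -> R).
Hypothesis C2L : Ck_on 2 [set: 'rV[R]_D] L.
Notation grad := (grad L).
Notation H := (hessian L).

Let dL x : differentiable L x. Proof. by case: C2L => + _; apply. Qed.
Let dDL v x : differentiable ('D_v L) x.
Proof. by case: C2L => _ /(_ v)[+ _]; apply. Qed.
Let cDDL u v : continuous ('D_u ('D_v L)).
Proof. by move=> x; case: C2L => _ /(_ v)[_ /(_ u)]; apply. Qed.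

Lemma derive_dotp (f : 'rV[R]_D -> R) v x : differentiable f x ->
  'D_v f x = \sum_i v 0 i * 'D_(delta_mx 0 i) f x.
Proof.
move=> df; rewrite deriveE // {1}(row_sum_delta v) linear_sum.
by apply: eq_bigr => i _; rewrite linearZ /= deriveE.
Qed.

Lemma derive_grad v x : 'D_v L x = dotp v (grad x).
Proof. by rewrite derive_dotp // dotpE; apply: eq_bigr => i _; rewrite mxE. Qed.

(** The outer direction [u] pairs with the row index of the Hessian, the inner direction [v] with
    its column index. *)
Lemma derive_hessian u v x : 'D_u ('D_v L) x = dotp (u *m H x) v.
Proof.
have -> : 'D_v L = \sum_i v 0 i \*: 'D_(delta_mx 0 i) L.
  by apply/funext => y; rewrite fct_sumE derive_dotp.
rewrite derive_sum; last by move=> i; apply/derivableZ/diff_derivable.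
rewrite dotpE; apply: eq_bigr => j _.
rewrite deriveZ; last exact: diff_derivable.
rewrite derive_dotp // mulrC mxE; congr (_ * _).
by apply: eq_bigr => i _; rewrite mxE.
Qed.

Let second_difference x u v h : 0 < h -> exists a b : R,
  [/\ 0 <= a <= h, 0 <= b <= h &
   L (x + h *: u + h *: v) - L (x + h *: u) - L (x + h *: v) + L x =
   'D_v ('D_u L) (x + a *: u + b *: v) * h ^+ 2].
Proof.
move=> h0.
have cont (f g : R -> R) A :
    (forall t : R, is_derive t 1 f (g t)) -> {within A, continuous f}.
  move=> df; apply: continuous_subspaceT => t.
  by apply: differentiable_continuous; apply/derivable1_diffP; exact: ex_derive.
pose f t := L (x + h *: v + t *: u) - L (x + t *: u).
pose f' t := 'D_u L (x + h *: v + t *: u) - 'D_u L (x + t *: u).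
have df (t : R) : is_derive t 1 f (f' t) by apply: is_deriveB; apply: is_derive_line.
have [a] := MVT_segment (ltW h0) (fun s _ => df s) (cont _ _ _ df).
rewrite in_itv subr0 /= => ah e1.
pose k t := 'D_u L (x + a *: u + t *: v).
have dk (t : R) : is_derive t 1 k ('D_v ('D_u L) (x + a *: u + t *: v)).
  exact: is_derive_line.
have [b] := MVT_segment (ltW h0) (fun s _ => dk s) (cont _ _ _ dk).
rewrite in_itv subr0 /= => bh e2; exists a, b; split=> //.
have -> : L (x + h *: u + h *: v) - L (x + h *: u) - L (x + h *: v) + L x =
          f h - f 0.
  by rewrite /f !scale0r !addr0 [x + h *: v + _]addrAC; ring.
rewrite e1 expr2 mulrA -e2 /k /f' scale0r addr0.
by rewrite [x + h *: v + _]addrAC.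
Qed.

(** Schwarz's theorem: the second difference is symmetric in [u] and [v], so one mixed derivative at
    some point of a small box at [x] equals the other one at another point of it; continuity then
    brings both points to [x]. *)
Lemma derive_comm u v x : 'D_u ('D_v L) x = 'D_v ('D_u L) x.
Proof.
apply/eqP; rewrite -subr_eq0 -normr_le0; apply/ler_addgt0Pr => e e0; rewrite add0r.
have e20 : 0 < e / 2 by rewrite divr_gt0.
have near_box (f : 'rV[R]_D -> R) : continuous f ->
    \forall h \near 0^'+, forall a b : R, 0 <= a <= h -> 0 <= b <= h ->
    `|f x - f (x + a *: u + b *: v)| <= e / 2.
  move=> cf; have /cvgrPdist_le/(_ _ e20)/nbhs_ballP[d /= d0 hd] := cf x.
  have n0 : 0 < `|u| + `|v| + 1 by rewrite ltr_pwDr // addr_ge0.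
  near=> h => a b /andP[a0 ah] /andP[b0 bh]; apply: hd.
  rewrite -ball_normE /= -addrA opprD addNKr normrN.
  apply: le_lt_trans (ler_normD _ _) _; rewrite !normrZ !ger0_norm //.
  apply: (@le_lt_trans _ _ (h * (`|u| + `|v| + 1))).
    have := ler_wpM2r (normr_ge0 u) ah; have := ler_wpM2r (normr_ge0 v) bh.
    have : 0 <= h by apply: le_trans ah.
    by rewrite !mulrDr; lra.
  rewrite -ltr_pdivlMr //; near: h.
  by apply: nbhs_right_lt; rewrite divr_gt0.
have boxuv := near_box _ (cDDL (u := u) (v := v)).
have boxvu := near_box _ (cDDL (u := v) (v := u)).
have [h [[buv bvu] h0]] :=
  filter_ex (filterI (filterI boxuv boxvu) (nbhs_right_gt (0 : R))).
have [a [b [ah bh e1]]] := second_difference x u v h0.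
have [b' [a' [b'h a'h e2]]] := second_difference x v u h0.
have e3 : 'D_u ('D_v L) (x + a' *: u + b' *: v) = 'D_v ('D_u L) (x + a *: u + b *: v).
  apply: (mulIf (lt0r_neq0 (exprn_gt0 2 h0))); rewrite (addrAC x (a' *: u)).
  apply: (etrans (esym e2)); apply: (etrans _ e1).
  by rewrite (addrAC x (h *: v)) (addrAC (L _) (- L (x + h *: v))).
have n1 := buv _ _ a'h b'h; have n2 := bvu _ _ ah bh.
apply: le_trans (ler_distD ('D_u ('D_v L) (x + a' *: u + b' *: v)) _ _) _.
rewrite (splitr e); apply: lerD; first exact: n1.
rewrite distrC.
exact: (eq_ind_r (fun y => `|'D_v ('D_u L) x - y| <= e / 2) n2 e3).
Unshelve. all: by end_near. Qed.

Lemma hessian_sym x : (H x)^T = H x.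
Proof. by apply/matrixP => i j; rewrite !mxE derive_comm. Qed.

Let is_derive_L1 x v (t : R) :
  is_derive t 1 (fun s : R => L (x + s *: v)) (dotp v (grad (x + t *: v))).
Proof. by rewrite -derive_grad; apply: is_derive_line. Qed.

Let is_derive_L2 x v (t : R) :
  is_derive t 1 (fun s : R => dotp v (grad (x + s *: v)))
    (dotp (v *m H (x + t *: v)) v).
Proof.
have -> : (fun s : R => dotp v (grad (x + s *: v))) =
    (fun s : R => 'D_v L (x + s *: v)).
  by apply/funext => s; rewrite derive_grad.
by rewrite -derive_hessian; apply: is_derive_line.
Qed.

Lemma le_taylor x v c r : 0 <= r ->
  (forall t, 0 <= t <= r -> c <= dotp (v *m H (x + t *: v)) v) ->
  L x + dotp v (grad x) * r + c * r ^+ 2 / 2 <= L (x + r *: v).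
Proof.
move=> r0 cH; have := ge_taylor2 (is_derive_L1 x v) (is_derive_L2 x v) r0 cH.
by rewrite scale0r addr0.
Qed.

Lemma taylor_le x v c r : 0 <= r ->
  (forall t, 0 <= t <= r -> dotp (v *m H (x + t *: v)) v <= c) ->
  L (x + r *: v) <= L x + dotp v (grad x) * r + c * r ^+ 2 / 2.
Proof.
move=> r0 cH.
have d1 (t : R) := is_deriveN (is_derive_L1 x v t).
have d2 (t : R) := is_deriveN (is_derive_L2 x v t).
have cH' t : 0 <= t <= r -> - c <= - dotp (v *m H (x + t *: v)) v.
  by move=> /cH; rewrite lerN2.
have : - L (x + 0 *: v) + (- dotp v (grad (x + 0 *: v))) * r + - c * r ^+ 2 / 2
    <= - L (x + r *: v) := ge_taylor2 d1 d2 r0 cH'.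
rewrite scale0r addr0; lra.
Qed.

Lemma ler_coord_dotp n (w : 'rV[R]_n) i j : `|w 0 i * w 0 j| <= dotp w w.
Proof.
have sq k : w 0 k ^+ 2 <= dotp w w.
  rewrite dotpE (bigD1 k) //= -expr2 lerDl; apply: sumr_ge0 => l _.
  by rewrite -expr2 sqr_ge0.
rewrite normrM; have := sq i; have := sq j.
rewrite -(real_normK (num_real (w 0 i))) -(real_normK (num_real (w 0 j))).
have := sqr_ge0 (`|w 0 i| - `|w 0 j|); lra.
Qed.

Lemma ler_quad n (A : 'M[R]_n) e (w : 'rV[R]_n) : (forall i j, `|A i j| <= e) ->
  `|dotp (w *m A) w| <= n%:R ^+ 2 * e * dotp w w.
Proof.
move=> Ae; rewrite dotpE; under eq_bigr => j _ do rewrite mxE mulr_suml.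
apply: le_trans (ler_norm_sum _ _ _) _.
have -> : n%:R ^+ 2 * e * dotp w w = \sum_(j < n) \sum_(i < n) e * dotp w w.
  by rewrite !sumr_const !card_ord expr2 -!mulrA !mulr_natl.
apply: ler_sum => j _; apply: le_trans (ler_norm_sum _ _ _) _.
apply: ler_sum => i _; rewrite mulrAC normrM mulrC.
by apply: ler_pM => //; apply: ler_coord_dotp.
Qed.

Lemma continuous_hessian i j : continuous (fun x => H x i j).
Proof.
have -> : (fun x => H x i j) = 'D_(delta_mx 0 i) ('D_(delta_mx 0 j) L).
  by apply/funext => x; rewrite mxE.
exact: cDDL.
Qed.

Lemma near_hessian p e : 0 < e -> \forall y \near p, forall w : 'rV[R]_D,
  `|dotp (w *m H y) w - dotp (w *m H p) w| <= e * dotp w w.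
Proof.
(* This [d] makes [D%:R ^+ 2 * d <= e]; the [+ 1] keeps the denominator positive when [D = 0]. *)
move=> e0; set d := e / (D%:R ^+ 2 + 1).
have D0 : 0 < D%:R ^+ 2 + 1 :> R by rewrite ltr_wpDl // sqr_ge0.
have d0 : 0 < d by rewrite divr_gt0.
have : \forall y \near p, forall i, forall j, `|H p i j - H y i j| <= d.
  apply: (@filter_forall _ _ (fun i y => forall j, `|H p i j - H y i j| <= d) (nbhs p) _) => i.
  apply: (@filter_forall _ _ (fun j y => `|H p i j - H y i j| <= d) (nbhs p) _) => j.
  by have /cvgrPdist_le/(_ _ d0) := @continuous_hessian i j p.
apply: filterS => y Hy w; rewrite -dotpBl -mulmxBr.
have /(ler_quad w)/le_trans -> // : forall i j, `|(H y - H p) i j| <= d.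
  by move=> i j; rewrite [X in `|X|]mxE [X in _ + X]mxE distrC; exact: Hy.
rewrite ler_wpM2r ?dotp_ge0 // /d mulrC -mulrA -[leRHS]mulr1 ler_wpM2l // ?ltW //.
by rewrite mulrC ltr_pdivrMr // mul1r ltrDl.
Qed.

(** Along the line in the direction of the gradient [g] itself, the derivative of [L] at [p] is
    [dotp g g], and it vanishes at a minimum. *)
Lemma grad_local_minimizer p : local_minimizer L p -> grad p = 0.
Proof.
move=> mp; apply/eqP; rewrite -dotp_eq0; set g := grad p.
have : is_derive (0 : R) 1 (fun s : R => L (p + s *: g)) 0.
  have /nbhs_ballP[d /= d0 hd] := mp.
  have n0 : 0 < `|g| + 1 by rewrite ltr_wpDl.
  have r0 : 0 < d / (`|g| + 1) by rewrite divr_gt0.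
  apply: (@derive1_at_min _ _ (- (d / (`|g| + 1))) (d / (`|g| + 1))).
  - lra.
  - by move=> t _; apply: ex_derive; exact: is_derive_L1.
  - by rewrite in_itv /=; lra.
  - move=> t; rewrite in_itv /= -ltr_norml => td; rewrite scale0r addr0.
    apply: hd; rewrite -ball_normE /= opprD addNKr normrN normrZ.
    apply: le_lt_trans (_ : `|t| * (`|g| + 1) < _); last by rewrite -ltr_pdivlMr.
    by rewrite ler_wpM2l // lerDl.
move=> /@derive_val <-; have := is_derive_L1 p g 0 => /@derive_val ->.
by rewrite scale0r addr0.
Qed.

(** If the form had a negative value [q] at [w], it would stay at most [q / 2] along a short segment
    from [p], and Taylor's bound would put [L] at the end of the segment below [L p]. *)
Lemma hessian_local_minimizer p (w : 'rV[R]_D) : local_minimizer L p ->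
  0 <= dotp (w *m H p) w.
Proof.
move=> mp; have [->|w0] := eqVneq w 0; first by rewrite mul0mx dotp0l.
rewrite leNgt; apply/negP => neg; set q := dotp _ _ in neg.
have ww : 0 < dotp w w by rewrite dotp_gt0.
have e0 : 0 < - q / 2 / dotp w w by rewrite !divr_gt0 // oppr_gt0.
have : \forall y \near p, L p <= L y /\ forall u : 'rV[R]_D,
    `|dotp (u *m H y) u - dotp (u *m H p) u| <= (- q / 2 / dotp w w) * dotp u u.
  by apply: filterI mp _; exact: near_hessian.
move=> /nbhs_ballP[d /= d0 hd].
have n0 : 0 < `|w| + 1 by rewrite ltr_wpDl.
set r := d / (`|w| + 1) / 2.
have r0 : 0 < r by rewrite !divr_gt0.
have inb t : 0 <= t <= r -> ball p d (p + t *: w).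
  move=> /andP[t0 tr]; rewrite -ball_normE /= opprD addNKr normrN normrZ ger0_norm //.
  apply: le_lt_trans (_ : r * (`|w| + 1) < _).
    by rewrite ler_pM // lerDl.
  by rewrite /r mulrAC divfK ?gt_eqF //; lra.
have aux (a b c : R) : c = - b / 2 -> `|a - b| <= c -> a <= b / 2.
  by move=> ->; rewrite ler_norml => /andP[_]; lra.
have Hq t : 0 <= t <= r -> dotp (w *m H (p + t *: w)) w <= q / 2.
  move=> tr; have [_ /(_ w)] := hd _ (inb t tr).
  by apply: aux; rewrite divfK // gt_eqF.
have := taylor_le (ltW r0) Hq.
rewrite grad_local_minimizer // dotpC dotp0l mul0r addr0.
have rr : 0 <= r <= r by rewrite lexx ltW.
have [Lp _] := hd _ (inb r rr); move=> le1; have := le_trans Lp le1.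
have : q * r ^+ 2 < 0 by rewrite nmulr_rlt0 // exprn_gt0.
clearbody q; lra.
Qed.
End C2.
End Calculus.

(** * The gradient near the manifold of minimizers *)

Section RowNorm.
Variable R : realType.

Lemma ler_coord_norm n (x : 'rV[R]_n) i : `|x 0 i| <= `|x|.
Proof. by rewrite [leRHS]/Num.Def.normr /= mx_normrE; apply: (le_bigmax _ _ (0, i)). Qed.

Lemma rV_norm_le n (x : 'rV[R]_n) c : 0 <= c -> (forall i, `|x 0 i| <= c) ->
  `|x| <= c.
Proof.
move=> c0 xc; rewrite /Num.Def.normr /= mx_normrE; apply: bigmax_le => // -[i j] _ /=.
by rewrite ord1.
Qed.

Lemma ler_coord_mulmx m n (w : 'rV[R]_m) (E : 'M[R]_(m, n)) e i :
  (forall k, `|E k i| <= e) -> `|(w *m E) 0 i| <= m%:R * e * `|w|.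
Proof.
move=> Ee; rewrite mxE; apply: le_trans (ler_norm_sum _ _ _) _.
have -> : m%:R * e * `|w| = \sum_(k < m) e * `|w|.
  by rewrite sumr_const card_ord -mulrA mulr_natl.
apply: ler_sum => k _; rewrite normrM mulrC.
by apply: ler_pM => //; apply: ler_coord_norm.
Qed.

Lemma dotp_le_norm n (x : 'rV[R]_n) : dotp x x <= n%:R * `|x| ^+ 2.
Proof.
rewrite dotpE mulr_natl -[X in _ *+ X]card_ord -sumr_const.
apply: ler_sum => i _; rewrite -expr2 -real_normK ?num_real //.
by rewrite lerXn2r ?nnegrE // ler_coord_norm.
Qed.

Lemma norm_le_dotp n (x : 'rV[R]_n) : `|x| ^+ 2 <= dotp x x.
Proof.
rewrite -[leRHS]sqr_sqrtr ?dotp_ge0 // lerXn2r ?nnegrE ?sqrtr_ge0 //.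
apply: rV_norm_le; first exact: sqrtr_ge0.
move=> i; rewrite -sqrtr_sqr ler_wsqrtr // expr2.
by apply: le_trans (ler_norm _) (ler_coord_dotp _ _ _).
Qed.

(** Here [N = Q *m N], so the column space of [N] lies in that of [Q]; equal ranks make them
    coincide. The factor [X] recovers the normal part of a vector from its image under [N]. *)
Lemma rank_copid_factor D M (N : 'M[R]_D) : (M <= D)%N -> \rank N = M ->
  (pid_mx (D - M) : 'M[R]_D) *m N = 0 -> exists X : 'M[R]_D, copid_mx (D - M) = N *m X.
Proof.
move=> MD rN PN; set Q := copid_mx _.
have QN : N = Q *m N by rewrite mulmxBl mul1mx PN subr0.
have sub : (N^T <= Q^T)%MS by rewrite QN trmx_mul submxMl.
have rQ : \rank Q = M by rewrite rank_copid_mx ?leq_subr // subKn.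
have := mxrank_leqif_sup sub; rewrite !mxrank_tr rN rQ => -[_].
rewrite eqxx => /esym/submxP[Y QY]; exists Y^T.
by apply: trmx_inj; rewrite QY trmx_mul trmxK.
Qed.

End RowNorm.

(** * The gradient in a chart flattening [Gamma] *)

Section Chart.
Variables (R : realType) (D M : nat) (L : 'rV[R]_D -> R) (Gamma : set 'rV[R]_D).
Hypotheses (MD : (M <= D)%N) (C2L : Ck_on 2 [set: 'rV[R]_D] L).
Hypothesis minG : forall x, Gamma x -> local_minimizer L x.
Hypothesis rankG : forall x, Gamma x -> \rank (hessian L x) = M.
Notation grad := (grad L).
Notation H := (hessian L).
Notation m := (D - M)%N.

Variables (A B : set 'rV[R]_D) (phi psi : 'rV[R]_D -> 'rV[R]_D) (p : 'rV[R]_D).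
Hypotheses (oA : open A) (Ap : A p) (oB : open B) (Gp : Gamma p).
Hypotheses (Cphi : Ck_on 1 A phi) (Cpsi : Ck_on 1 B psi).
Hypotheses (phiA : phi @` A `<=` B) (psiB : psi @` B `<=` A).
Hypotheses (psiK : forall x, A x -> psi (phi x) = x)
           (phiK : forall y, B y -> phi (psi y) = y).
Hypothesis flat : forall x, A x ->
  (Gamma x <-> forall i : 'I_D, (m <= i)%N -> phi x 0 i = 0).

Let z0 := phi p.
Let Bz0 : B z0. Proof. by apply: phiA; exists p. Qed.
(** Projection onto the coordinates tangent to [Gamma] in the chart. *)
Let P : 'M[R]_D := pid_mx m.
(** By the chain rule this is the derivative at [y] of [z |-> grad (psi z)], acting on row
    vectors. *)
Let N y := jacobian psi y *m H (psi y).

Let mulP (z : 'rV[R]_D) i : (z *m P) 0 i = if (i < m)%N then z 0 i else 0.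
Proof.
rewrite mxE (bigD1 i) //= big1 ?addr0 => [|k ki].
  by rewrite !mxE eqxx; case: ifP; rewrite ?mulr1 ?mulr0.
by rewrite !mxE (_ : (_ == _ :> nat) = false) ?mulr0 //; apply/negbTE.
Qed.

Let gamma_flat z : B z -> z *m P = z -> Gamma (psi z).
Proof.
move=> Bz zP; have Apz : A (psi z) by apply: psiB; exists z.
by apply/(flat Apz) => i mi; rewrite phiK // -zP mulP ltnNge mi.
Qed.

Let z0P : z0 *m P = z0.
Proof.
apply/rowP => i; rewrite mulP; case: ltnP => // mi.
by have /(flat Ap) -> := Gp.
Qed.

Let dpsi y : B y -> differentiable psi y. Proof. by case: Cpsi => + _; apply. Qed.
Let dDL v x : differentiable ('D_v L) x.
Proof. by case: C2L => _ /(_ v)[+ _]; apply. Qed.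

Let derive_F (i : 'I_D) w y : B y ->
  differentiable ('D_(delta_mx 0 i) L \o psi) y /\
  'D_w ('D_(delta_mx 0 i) L \o psi) y = (w *m N y) 0 i.
Proof.
move=> By; have dc : differentiable ('D_(delta_mx 0 i) L \o psi) y.
  by apply: differentiable_comp => //; exact: dpsi.
split=> //; rewrite deriveE // diff_comp //; last exact: dpsi.
rewrite /= -deriveE // -deriveE ?deriveEjacobian //; try exact: dpsi.
rewrite derive_hessian // dotpC /N mulmxA dotpE (bigD1 i) //= big1 ?addr0.
  by rewrite !mxE !eqxx mul1r.
by move=> j ji; rewrite !mxE (negPf ji) andbF mul0r.
Qed.

Let gradE x i : grad x 0 i = 'D_(delta_mx 0 i) L x. Proof. by rewrite mxE. Qed.

(** The chain rule applied to [phi (psi y) = y] near [z0] exhibits the Jacobian of [phi] at [p] as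
    an inverse. *)
Let jacobian_unit : jacobian psi z0 \in unitmx.
Proof.
have dphi : differentiable phi p by case: Cphi => + _; apply.
have psiz0 : psi z0 = p by rewrite /z0 psiK.
suff : jacobian psi z0 *m jacobian phi p = 1%:M.
  by move=> /mulmx1_unit[u _]; exact: u.
apply/row_matrixP => i; rewrite !rowE mulmx1 mulmxA.
rewrite -!deriveEjacobian //; last exact: dpsi.
rewrite deriveE // deriveE; last exact: dpsi.
rewrite -psiz0 -[LHS]/(('d phi (psi z0) \o 'd psi z0) _).
rewrite -diff_comp ?psiz0 //; last exact: dpsi.
rewrite -deriveE; last by apply: differentiable_comp; rewrite ?psiz0 //; exact: dpsi.
rewrite -[RHS](derive_id z0); apply: near_eq_derive.
by have := open_nbhs_nbhs (conj oB Bz0); apply: filterS => y By; rewrite /= phiK.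
Qed.

(** For small [t] the points [psi (z0 + t *: (v *m P))] lie on [Gamma], where the gradient vanishes;
    hence its derivative in tangential directions is zero. *)
Let PN0 : P *m N z0 = 0.
Proof.
apply/row_matrixP => k; rewrite row0 rowE mulmxA; set v := delta_mx 0 k.
apply/rowP => i; rewrite [RHS]mxE.
have [dF <-] := derive_F i (v *m P) Bz0.
have -> : 'D_(v *m P) ('D_(delta_mx 0 i) L \o psi) z0 =
          'D_1 (fun t : R => ('D_(delta_mx 0 i) L \o psi) (z0 + t *: (v *m P))) (0 : R).
  apply/esym; apply: derive_val; rewrite -{2}[z0]addr0 -(scale0r (v *m P)).
  by apply: is_derive_line; rewrite scale0r addr0.
transitivity ('D_1 (cst 0 : R -> R) (0 : R)); last by rewrite derive_cst.
apply: near_eq_derive.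
have cl : (fun t : R => z0 + t *: (v *m P)) @ (0 : R) --> z0.
  rewrite -{2}[z0]addr0 -(scale0r (v *m P)); apply: cvgD; first exact: cvg_cst.
  by apply: cvgZr_tmp; exact: cvg_id.
have : \forall t \near (0 : R), B (z0 + t *: (v *m P)).
  by apply: cl; apply: open_nbhs_nbhs.
apply: filterS => t Bt; rewrite /=.
rewrite -gradE grad_local_minimizer ?mxE //; apply/minG/gamma_flat => //.
by rewrite mulmxDl z0P -scalemxAl -mulmxA pid_mx_id ?leq_subr.
Qed.

(** As the Jacobian is invertible, [N z0] has the rank [M] of the Hessian. *)
Let normal_factor : exists X : 'M[R]_D, copid_mx m = N z0 *m X.
Proof.
apply: rank_copid_factor PN0 => //.
rewrite /N -mxrank_tr trmx_mul mxrankMfree ?mxrank_tr ?rankG //.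
  by apply/gamma_flat.
by rewrite row_free_unit unitmx_tr.
Qed.

Let deltaE (J : 'M[R]_D) i j : ((delta_mx 0 i : 'rV_D) *m J) 0 j = J i j.
Proof. by rewrite -rowE mxE. Qed.

Let continuous_jacobian i j : {for z0, continuous (fun y => jacobian psi y i j)}.
Proof.
have cD : {for z0, continuous ('D_(delta_mx 0 i) psi)}.
  by case: Cpsi => _ /(_ (delta_mx 0 i)) /(_ _ Bz0).
have cj : {for z0, continuous (fun y => ('D_(delta_mx 0 i) psi y) 0 j)}.
  apply: (@continuous_comp _ _ _ _ (fun u : 'rV[R]_D => u 0 j)) => //.
  exact: coord_continuous.
have jE y : B y -> ('D_(delta_mx 0 i) psi y) 0 j = jacobian psi y i j.
  by move=> By; rewrite deriveEjacobian ?deltaE //; exact: dpsi.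
apply: (@cvg_trans _ ((fun y => ('D_(delta_mx 0 i) psi y) 0 j) @ z0)).
  apply: (@near_eq_cvg _ _ (nbhs z0) _).
  by apply: (@filterS _ (nbhs z0) _ B) jE _; exact: open_nbhs_nbhs.
by rewrite -(jE _ Bz0); exact: cj.
Qed.

Let continuous_psi : {for z0, continuous psi}.
Proof. exact/differentiable_continuous/dpsi. Qed.

Let continuous_N i j : {for z0, continuous (fun y => N y i j)}.
Proof.
pose f (k : 'I_D) y := jacobian psi y i k * H (psi y) k j.
have -> : (fun y => N y i j) = (fun y => \sum_k f k y).
  by apply/funext => y; rewrite mxE.
have cf k : f k @ z0 --> f k z0.
  apply: continuousM; first exact: continuous_jacobian.
  apply: (@continuous_comp _ _ _ psi (fun x => H x k j)); first exact: continuous_psi.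
  exact: continuous_hessian.
exact: (@cvg_big _ _ _ _ xpredT (@add_continuous _) _ (nbhs z0) _ f (f^~ z0)
  (nbhs_filter z0) (fun k _ => cf k)).
Qed.

(** [P] fixes [z0] and replaces coordinates of [z0 - z] by 0, which cannot increase the sup norm. *)
Let mulP_near z d : ball z0 d z -> ball z0 d (z *m P).
Proof.
rewrite -ball_normE /= => zd; apply: le_lt_trans zd; apply: rV_norm_le => // i.
rewrite -{1}z0P -mulmxBl mulP; case: ifP => _; last by rewrite normr0.
exact: ler_coord_norm.
Qed.

Let segment_near z d (t : R) : ball z0 d z -> 0 <= t <= 1 ->
  ball z0 d (z *m P + t *: (z - z *m P)).
Proof.
move=> zd /andP[t0 t1]; have zPd := mulP_near zd.
move: zd zPd; rewrite -ball_normE /= => zd zPd.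
have -> : z0 - (z *m P + t *: (z - z *m P)) =
    (1 - t) *: (z0 - z *m P) + t *: (z0 - z).
  by apply/rowP => i; rewrite !mxE; ring.
apply: le_lt_trans (ler_normD _ _) _; rewrite !normrZ ger0_norm ?subr_ge0 //.
rewrite ger0_norm //; move: zd zPd.
move: (`|z0 - z|) (`|z0 - z *m P|) => a b ad bd.
have cd : Num.max a b < d by rewrite gt_max ad.
apply: le_lt_trans cd.
have am : t * a <= t * Num.max a b by rewrite ler_wpM2l // le_max lexx.
have bm : (1 - t) * b <= (1 - t) * Num.max a b.
  by rewrite ler_wpM2l ?subr_ge0 // le_max lexx orbT.
by move: (Num.max a b) am bm => c; lra.
Qed.

Let near_N d : 0 < d -> \forall y \near z0, B y /\
  forall i k, `|N z0 k i - N y k i| <= d.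
Proof.
move=> d0; apply: (@filterI _ (nbhs z0) _); first exact (open_nbhs_nbhs (conj oB Bz0)).
apply: (@filter_forall _ _ (fun i y => forall k, `|N z0 k i - N y k i| <= d) (nbhs z0) _) => i.
apply: (@filter_forall _ _ (fun k y => `|N z0 k i - N y k i| <= d) (nbhs z0) _) => k.
by have /cvgrPdist_le/(_ _ d0) := @continuous_N k i.
Qed.

(* The gradient at [x = psi z] is compared with its value, zero, at the point
   [psi (z *m P)] of [Gamma]: the mean value theorem makes it close to
   [(z - z *m P) *m N z0], which lies in the range of the Hessian at [p]. *)
Lemma near_range e : 0 < e -> \forall x \near p, exists2 u : 'rV[R]_D,
  exists k : 'rV[R]_D, u = k *m H p &
  dotp (grad x - u) (grad x - u) <= e * dotp u u.
Proof.
move=> e0; have [X QX] := normal_factor.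
set K := D%:R * `|X|.
have wX (w : 'rV[R]_D) : `|w *m X| <= K * `|w|.
  apply: rV_norm_le => [|i]; first by rewrite !mulr_ge0.
  apply: ler_coord_mulmx => k; rewrite [leRHS]/Num.Def.normr /= mx_normrE.
  by apply: (le_bigmax _ _ (k, i)).
(* [a] and [dl] are chosen so that the final factor [D%:R ^+ 3 * K ^+ 2 * dl ^+ 2] is at most [e];
   the [+ 1] keeps [a] positive. *)
pose a := D%:R ^+ 3 * K ^+ 2 + 1.
have a0 : 0 < a by rewrite ltr_wpDl // mulr_ge0 ?sqr_ge0 ?exprn_ge0.
pose dl := Num.sqrt (e / a).
have dl0 : 0 < dl by rewrite sqrtr_gt0 divr_gt0.
have /nbhs_ballP[r /= r0 Nr] := near_N dl0.
have cphi : {for p, continuous phi}.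
  by apply: differentiable_continuous; case: Cphi => + _; apply.
have nearphi : \forall x \near p, ball z0 r (phi x).
  by apply: cphi; apply: nbhsx_ballx.
have nearA : \forall x \near p, A x by exact: open_nbhs_nbhs.
apply: filterS2 nearA nearphi => x Ax; set z := phi x => zr.
set w := z - z *m P; set u := w *m N z0.
have Bz t : 0 <= t <= 1 -> B (z *m P + t *: w).
  by move=> t01; have [] := Nr _ (segment_near zr t01).
have psiz0 : psi z0 = p by rewrite /z0 psiK.
exists u; first by exists (w *m jacobian psi z0); rewrite /u /N psiz0 mulmxA.
have wE : w = z *m copid_mx m by rewrite mulmxBr mulmx1.
(* [w] is purely normal, so [X] recovers it from [u]: the size of [w] is controlled by that of
   [u]. *)
have wu : w = u *m X.
  by rewrite /u -mulmxA -QX wE -mulmxA copid_mx_id ?leq_subr.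
(* The mean value theorem is used for each coordinate separately, on the segment from [z *m P] to
   [z]; the intermediate point [c] depends on [i]. *)
have err i : `|(grad x - u) 0 i| <= D%:R * dl * `|w|.
  pose f (t : R) := ('D_(delta_mx 0 i) L \o psi) (z *m P + t *: w).
  have df (t : R) : 0 <= t <= 1 -> is_derive t 1 f ((w *m N (z *m P + t *: w)) 0 i).
    move=> t01; have [dF <-] := derive_F i w (Bz _ t01).
    exact: is_derive_line.
  have cf : {within `[0, 1], continuous f}.
    apply: derivable_within_continuous => t; rewrite in_itv /= => t01.
    by apply: ex_derive; exact: df.
  have df' (t : R) : t \in `]0, 1[ -> is_derive t 1 f ((w *m N (z *m P + t *: w)) 0 i).
    by rewrite in_itv /= => /andP[t0 t1]; apply: df; rewrite !ltW.
  have [c] := MVT_segment ler01 df' cf.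
  rewrite in_itv /= => c01; rewrite subr0 mulr1.
  have B0 : B (z *m P) by have := Bz 0; rewrite scale0r addr0 lexx ler01; apply.
  have -> : f 0 = 0.
    rewrite /f scale0r addr0 /= -gradE grad_local_minimizer ?mxE //.
    apply/minG/gamma_flat => //.
    by rewrite -mulmxA pid_mx_id ?leq_subr.
  have -> : f 1 = grad x 0 i.
    by rewrite /f scale1r addrC subrK /= psiK // gradE.
  rewrite subr0 => gE.
  have -> : (grad x - u) 0 i = (w *m (N (z *m P + c *: w) - N z0)) 0 i.
    by rewrite mulmxBr [LHS]mxE [RHS]mxE gE [in LHS]mxE [in RHS]mxE.
  apply: ler_coord_mulmx => k; rewrite [X in `|X|]mxE [X in _ + X]mxE distrC.
  by have [_] := Nr _ (segment_near zr c01); apply.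
have nerr : `|grad x - u| <= D%:R * dl * `|w|.
  by apply: rV_norm_le => //; rewrite !mulr_ge0 // ltW.
have wK : `|w| <= K * `|u| by rewrite {1}wu.
apply: le_trans (dotp_le_norm _) _.
have nerr2 : `|grad x - u| ^+ 2 <= (D%:R * dl * (K * `|u|)) ^+ 2.
  rewrite lerXn2r ?nnegrE ?mulr_ge0 ?(ltW dl0) //.
  by apply: le_trans nerr _; rewrite ler_wpM2l // mulr_ge0 // ltW.
apply: le_trans (ler_wpM2l (ler0n _ _) nerr2) _.
have -> : D%:R * (D%:R * dl * (K * `|u|)) ^+ 2 =
    D%:R ^+ 3 * K ^+ 2 * dl ^+ 2 * `|u| ^+ 2 by ring.
apply: ler_pM; rewrite ?mulr_ge0 ?exprn_ge0 ?sqr_ge0 ?norm_le_dotp ?(ltW dl0) //.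
rewrite sqr_sqrtr; last by rewrite divr_ge0 ?ltW.
rewrite mulrCA -[leRHS]mulr1 ler_wpM2l ?(ltW e0) // ler_pdivrMr // mul1r.
by rewrite lerDl.
Qed.
End Chart.

Lemma Ck_onW (R : realType) (V W : normedModType R) k (A : set V) (f : V -> W) :
  Ck_on k.+1 A f -> Ck_on k A f.
Proof.
elim: k f => [|k IH] f [df dvf]; first by move=> x /df /differentiable_continuous.
by split=> // v; apply: IH.
Qed.

(** * The Euclidean norm and normalization of vectors *)

Section L2norm.
Variables (R : realType) (n : nat).
Implicit Types x : 'rV[R]_n.

Lemma l2normE x : l2norm x = Num.sqrt (dotp x x).
Proof. by rewrite /l2norm dotpE; congr Num.sqrt; apply: eq_bigr => i _; rewrite expr2. Qed.

Lemma l2norm_ge0 x : 0 <= l2norm x. Proof. exact: sqrtr_ge0. Qed.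

Lemma sqr_l2norm x : l2norm x ^+ 2 = dotp x x.
Proof. by rewrite l2normE sqr_sqrtr // dotp_ge0. Qed.

Lemma norm_le_l2norm x : `|x| <= l2norm x.
Proof.
by rewrite -(@ler_pXn2r _ 2) ?nnegrE ?l2norm_ge0 // sqr_l2norm norm_le_dotp.
Qed.

Lemma l2norm_gt0 x : (0 < l2norm x) = (x != 0).
Proof. by rewrite l2normE sqrtr_gt0 dotp_gt0. Qed.

Lemma l2normZ a x : l2norm (a *: x) = `|a| * l2norm x.
Proof.
by rewrite !l2normE dotpZl dotpZr mulrA -expr2 sqrtrM ?sqr_ge0 // sqrtr_sqr.
Qed.

(** Applied to a nonzero gradient this is the ascent direction; at 0 its value is 0. *)
Definition l2unit x := (l2norm x)^-1 *: x.

Lemma dotp_l2unit x : x != 0 -> dotp (l2unit x) (l2unit x) = 1.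
Proof.
move=> x0; rewrite dotpZl dotpZr -sqr_l2norm.
by field; rewrite gt_eqF // l2norm_gt0.
Qed.

Lemma norm_l2unit x : `|l2unit x| <= 1.
Proof.
have [->|x0] := eqVneq x 0; first by rewrite /l2unit scaler0 normr0.
by apply: le_trans (norm_le_l2norm _) _; rewrite l2normE dotp_l2unit // sqrtr1.
Qed.

Lemma l2unitZ a x : 0 < a -> l2unit (a *: x) = l2unit x.
Proof.
move=> a0; rewrite /l2unit l2normZ gtr0_norm // scalerA.
have [->|x0] := eqVneq x 0; first by rewrite !scaler0.
by congr (_ *: _); field; rewrite -!l2norm_gt0 in x0 *; rewrite !gt_eqF.
Qed.

Lemma l2norm_continuous : continuous (@l2norm R n).
Proof.
move=> x; apply: (@continuous_comp _ _ _ (fun x : 'rV[R]_n => \sum_(i < n) x 0 i ^+ 2)).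
  apply: continuous_big => [|i _]; first exact: add_continuous.
  move=> y; apply: (@continuous_comp _ _ _ (fun x : 'rV[R]_n => x 0 i) (fun a => a ^+ 2)).
    exact: coord_continuous.
  exact: exprn_continuous.
exact: sqrt_continuous.
Qed.

Lemma l2unit_continuous x : x != 0 -> {for x, continuous l2unit}.
Proof.
move=> x0; apply: continuousZ; last by apply: cvg_id.
apply: continuousV; first by rewrite gt_eqF // l2norm_gt0.
exact: l2norm_continuous.
Qed.
End L2norm.

(** * Stability of the Rayleigh quotient under small perturbations *)

Section Rayleigh.
Variables (R : realType) (n : nat) (A : 'M[R]_n).
Hypotheses (sA : A^T = A) (pA : forall u : 'rV[R]_n, 0 <= dotp (u *m A) u).

(* The cross terms are absorbed using [0 <= (s u + e) A (s u + e)^T] and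
   [0 <= |s u - e|^2]. *)
Lemma rayleigh_perturb (u e : 'rV[R]_n) (l K s eta : R) :
  0 < s <= 1 -> 0 <= l -> 0 <= K -> s * (4 * l + K) <= eta ->
  l * dotp u u <= dotp (u *m A) u -> dotp (e *m A) e <= K * dotp e e ->
  dotp e e <= s ^+ 2 * dotp u u ->
  (l - eta) * dotp (u + e) (u + e) <= dotp ((u + e) *m A) (u + e).
Proof.
move=> /andP[s0 s1] l0 K0 sle lu Ke es.
have G0 := dotp_ge0 (u + e); have Q0 := pA (u + e); have U0 := dotp_ge0 u.
(* If [l - eta <= 0], semidefiniteness suffices; otherwise an upper bound on the squared length of
   [u + e] may be multiplied by [l - eta]. *)
have [le0|gt0] := lerP (l - eta) 0.
  by apply: le_trans Q0; rewrite mulr_le0_ge0.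
have := pA (s *: u + e); have := dotp_ge0 (s *: u - e).
rewrite mulmxDl (mulmxDl u) -scalemxAl !(dotpBl, dotpDl, dotpDr, dotpZl, dotpZr).
have -> : dotp u (- e) = - dotp u e by rewrite -scaleN1r dotpZr mulN1r.
have -> : dotp e (- e) = - dotp e e by rewrite -scaleN1r dotpZr mulN1r.
rewrite (dotpC e u).
have -> : dotp (e *m A) u = dotp (u *m A) e by rewrite dotp_sym // dotpC.
have c0 := pA e.
move: (dotp u u) (dotp u e) (dotp e e) (dotp (u *m A) u) (dotp (u *m A) e)
  (dotp (e *m A) e) lu Ke es U0 c0 => U d E a b c lu Ke es U0 c0 h1 h2.
(* In each auxiliary inequality the cross term carries a factor [s]; dividing by it leaves an error
   of order [s]. *)
have sb : - (s * a) - K * (s * U) <= 2 * b.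
  rewrite -(ler_pM2l s0).
  have : K * E <= K * (s ^+ 2 * U) by rewrite ler_wpM2l.
  by rewrite !expr2; nra.
have sd : 2 * d <= 2 * (s * U).
  by rewrite -(ler_pM2l s0); move: es; rewrite !expr2; nra.
have EU : E <= s * U.
  by apply: le_trans es _; rewrite expr2 -mulrA ler_piMl // mulr_ge0 // ltW.
have G1 : U + d + (d + E) <= (1 + 3 * s) * U by nra.
apply: (@le_trans _ _ ((l - eta) * ((1 + 3 * s) * U))).
  by rewrite ler_pM2l.
have a1 : (1 - s) * (l * U) <= (1 - s) * a by rewrite ler_wpM2l // subr_ge0.
apply: (@le_trans _ _ ((1 - s) * (l * U) - K * (s * U))); last by lra.
rewrite -subr_ge0.
(* This identity explains [4 * l + K] in the hypothesis on [s]: [s * l] is lost once through [1 - s]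
   and three times through [1 + 3 * s]. *)
have -> : (1 - s) * (l * U) - K * (s * U) - (l - eta) * ((1 + 3 * s) * U) =
  (eta - s * (4 * l + K) + 3 * s * eta) * U by ring.
rewrite mulr_ge0 // addr_ge0 ?subr_ge0 // mulr_ge0 ?mulr_ge0 ?(ltW s0) //.
by apply: le_trans sle; rewrite mulr_ge0 ?(ltW s0) // addr_ge0 // mulr_ge0.
Qed.
End Rayleigh.

(** * Bounds on the ascent-direction sharpness *)

Lemma ler_dist_of (R : realDomainType) (a b e : R) :
  a <= b + e -> b <= a + e -> `|b - a| <= e.
Proof. by move=> ab ba; rewrite ler_distlC lerBlDr ba ab. Qed.

Lemma ler_dist2 (R : realDomainType) (a b c e : R) :
  `|a - c| <= e -> `|b - c| <= e -> a <= b + (e + e).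
Proof. by rewrite !ler_norml => /andP[_ ac] /andP[bc _]; lra. Qed.

Lemma half_lerB (R : realFieldType) (a b e : R) :
  `|a - b| <= e -> b / 2 - e <= (a - e) / 2.
Proof. by rewrite ler_norml => /andP[]; lra. Qed.

Lemma lower_of_dist (R : realDomainType) (a b c k q : R) :
  `|a - b| <= 1 * q -> `|b| <= k * q -> (k + 1) * q <= c * q -> - c * q <= a.
Proof. by rewrite !ler_norml mulrDl mulNr => /andP[? _] /andP[? _]; lra. Qed.

Lemma half_lerD (R : realFieldType) (a e : R) :
  0 <= e -> (a + e) / 2 <= a / 2 + e.
Proof. lra. Qed.

Lemma abse_dist_lt (R : realType) (a e eps : R) (b : \bar R) : e < eps ->
  ((a - e)%:E <= b <= (a + e)%:E)%E -> (`|a%:E - b| < eps%:E)%E.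
Proof.
move=> eeps; case: b => [b| |]; last 2 first.
- by rewrite leye_eq andbF.
- by rewrite leeNy_eq.
rewrite !lee_fin -EFinB /= lte_fin => /andP[h1 h2].
by apply: le_lt_trans eeps; rewrite ler_norml; apply/andP; split; lra.
Qed.

Lemma rV_closed_ball_compact (R : realType) n (x : 'rV[R]_n) r :
  0 < r -> compact (closed_ball x r).
Proof.
move=> r0; apply: bounded_closed_compact; last exact: closed_ball_closed.
exists (`|x| + r); split; first exact: num_real.
move=> m ltm y; rewrite closed_ballE // /closed_ball_ /= => xy.
apply: le_trans (ltW ltm); rewrite -[y](subKr x).
by apply: le_trans (ler_normB _ _) _; rewrite lerD2l.
Qed.

(** * Uniform local estimates near the points of [Gamma] *)

Section Minimizers.
Variables (R : realType) (D M : nat) (L : 'rV[R]_D -> R) (Gamma : set 'rV[R]_D).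
Hypotheses (M0 : (0 < M)%N) (MD : (M <= D)%N) (C2L : Ck_on 2 [set: 'rV[R]_D] L).
Hypothesis subG : submanifold 2 (D - M)%N Gamma.
Hypothesis minG : forall x, Gamma x -> local_minimizer L x.
Hypothesis rankG : forall x, Gamma x -> \rank (hessian L x) = M.
Notation grad := (grad L).
Notation H := (hessian L).
Notation lam x := (lambda M (hessian L x)).
Notation asc := (asc_sharpness L).

Lemma lambda_hessian x : Gamma x -> [/\ 0 < lam x,
      exists2 v : 'rV[R]_D, v != 0 & v *m H x = lam x *: v &
      forall u : 'rV[R]_D, lam x * dotp (u *m H x) (u *m H x) <=
                dotp (u *m H x *m H x) (u *m H x)].
Proof.
move=> Gx; apply: lambda_spec => //; first exact: hessian_sym.
- by move=> u; apply: hessian_local_minimizer => //; exact: minG.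
- exact: rankG.
Qed.

Lemma near_range_hessian p e : Gamma p -> 0 < e ->
  \forall x \near p, exists2 u : 'rV[R]_D,
  exists k : 'rV[R]_D, u = k *m H p &
  dotp (grad x - u) (grad x - u) <= e * dotp u u.
Proof.
move=> Gp e0.
have [A [B [phi [psi [[oA Ap oB] [Cphi Cpsi phiA psiB] [psiK phiK] flat]]]]] := subG Gp.
exact: (@near_range R D M L Gamma MD C2L minG rankG A B phi psi p oA Ap oB Gp
  (Ck_onW Cphi) (Ck_onW Cpsi) phiA psiB psiK phiK flat e e0).
Qed.

(** Near [p] the gradient is a relatively small perturbation of a vector in the range of [H p],
    where the Rayleigh quotient is at least [lam p]. *)
Lemma near_rayleigh_grad p eta : Gamma p -> 0 < eta -> \forall x \near p,
  (lam p - eta) * dotp (grad x) (grad x) <= dotp (grad x *m H p) (grad x).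
Proof.
move=> Gp eta0; have [l0 _ lr] := lambda_hessian Gp.
pose K := D%:R ^+ 2 * `|H p|.
have K0 : 0 <= K by rewrite mulr_ge0 ?sqr_ge0.
have den : 0 < 4 * lam p + K + eta by rewrite ltr_wpDl // addr_ge0 // mulr_ge0 // ltW.
(* This choice gives both [s <= 1] and [s * (4 * lam p + K) <= eta]. *)
pose s := eta / (4 * lam p + K + eta).
have s0 : 0 < s by rewrite divr_gt0.
have s1 : s <= 1.
  by rewrite ler_pdivrMr // mul1r lerDr addr_ge0 // mulr_ge0 // ltW.
have sle : s * (4 * lam p + K) <= eta.
  rewrite mulrAC ler_pdivrMr // ler_pM2l // lerDl ltW //.
apply: filterS (near_range_hessian Gp (exprn_gt0 2 s0)) => x [u [k uk] es].
have -> : grad x = u + (grad x - u) by rewrite addrC subrK.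
apply: (@rayleigh_perturb _ _ _ _ _ _ _ (lam p) K s) => //.
- exact: hessian_sym.
- by move=> w; apply: hessian_local_minimizer => //; exact: minG.
- by rewrite s0.
- exact: ltW.
- by rewrite uk; exact: lr.
- apply: le_trans (ler_norm _) _; apply: ler_quad => i j.
  by rewrite [leRHS]/Num.Def.normr /= mx_normrE; apply: (le_bigmax _ _ (i, j)).
Qed.

(** The Hessian is taken at a point [y] independent of [x], because Taylor's bound evaluates it
    along a whole segment starting at [x]. *)
Lemma near_rayleigh p eta : Gamma p -> 0 < eta -> exists2 r, 0 < r &
  forall x y, ball p r x -> ball p r y ->
  (lam p - eta) * dotp (grad x) (grad x) <= dotp (grad x *m H y) (grad x).
Proof.
move=> Gp eta0; have eta2 : 0 < eta / 2 by rewrite divr_gt0.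
have /nbhs_ballP[r1 /= r10 h1] := near_rayleigh_grad Gp eta2.
have /nbhs_ballP[r2 /= r20 h2] := near_hessian C2L p eta2.
exists (Num.min r1 r2); first by rewrite lt_min r10.
move=> x y xr yr; have [m1 m2] : Num.min r1 r2 <= r1 /\ Num.min r1 r2 <= r2.
  by rewrite !ge_min !lexx orbT.
have {}h1 := h1 _ (le_ball m1 xr).
have aux (a b c l : R) : (l - eta / 2) * c <= b -> `|a - b| <= eta / 2 * c ->
    (l - eta) * c <= a by rewrite ler_norml => ? /andP[]; lra.
exact: aux h1 (h2 _ (le_ball m2 yr) (grad x)).
Qed.

Lemma lambda_near_le x y eta : Gamma x -> Gamma y ->
  (forall w : 'rV[R]_D,
     `|dotp (w *m H x) w - dotp (w *m H y) w| <= eta * dotp w w) ->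
  lam x <= lam y + eta.
Proof.
move=> Gx Gy xy; apply: lambda_le_add => //; try exact: hessian_sym.
- by move=> w; apply: hessian_local_minimizer => //; exact: minG.
- exact: rankG.
- by move=> w; apply: hessian_local_minimizer => //; exact: minG.
- exact: rankG.
- by move=> w; have := le_trans (ler_norm _) (xy w); rewrite lerBlDl.
Qed.

(** Closeness of the two Hessian forms is symmetric, so the Courant-Fischer comparison applies in
    both directions. *)
Lemma near_lambda p eta : Gamma p -> 0 < eta ->
  \forall x \near p, Gamma x -> `|lam p - lam x| <= eta.
Proof.
move=> Gp eta0; apply: filterS (near_hessian C2L p eta0) => x Hx Gx.
have le1 := lambda_near_le Gx Gp Hx.
have le2 : lam p <= lam x + eta.
  by apply: (lambda_near_le Gp Gx) => w; rewrite distrC; exact: (Hx w).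
exact: ler_dist_of le1 le2.
Qed.

(** In Taylor's bound along the ascent direction the first-order term is nonnegative, and the
    second-order one is governed by a Rayleigh quotient of the gradient. At critical points the
    value is [+oo]. *)
Lemma asc_ge p eta : Gamma p -> 0 < eta -> exists2 r, 0 < r &
  forall x rho, ball p r x -> 0 < rho < r ->
  (((lam p - eta) / 2 * rho ^+ 2)%:E <= asc rho x)%E.
Proof.
move=> Gp eta0; have [r r0 hr] := near_rayleigh Gp eta0.
(* Halving the radius keeps the segment of length [rho] from [x] inside the ball of radius [r]
   around [p]. *)
exists (r / 2); first by rewrite divr_gt0.
move=> x rho xr /andP[rho0 rhor]; rewrite /asc_sharpness.
case: ifPn => [_|g0]; first exact: leey.
rewrite lee_fin -/(l2unit (grad x)); set v := l2unit _.
have v1 : dotp v v = 1 by exact: dotp_l2unit.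
have xr' : `|p - x| < r / 2 by move: xr; rewrite -ball_normE.
have Hv t : 0 <= t <= rho -> lam p - eta <= dotp (v *m H (x + t *: v)) v.
  move=> /andP[t0 tr].
  have yr : ball p r (x + t *: v).
    rewrite -ball_normE /= opprD addrA; apply: le_lt_trans (ler_normB _ _) _.
    rewrite normrZ ger0_norm //.
    have : t * `|v| <= rho * 1 by apply: ler_pM => //; exact: norm_l2unit.
    by lra.
  have xr2 : ball p r x by rewrite -ball_normE /=; lra.
  have := hr _ _ xr2 yr.
  (* Division by the squared length of the gradient turns the estimate for [grad x] into one for the
     unit vector [v]. *)
  rewrite -(ler_pM2l (_ : 0 < (l2norm (grad x))^-1 ^+ 2)); last first.
    by rewrite exprn_gt0 // invr_gt0 l2norm_gt0.
  rewrite /v /l2unit -scalemxAl !dotpZl !dotpZr -sqr_l2norm.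
  rewrite [in X in X -> _]mulrCA -exprMn mulVf ?gt_eqF ?l2norm_gt0 //.
  by rewrite expr1n mulr1 expr2 -mulrA.
have := le_taylor C2L (ltW rho0) Hv.
have vg : 0 <= dotp v (grad x) * rho.
  by rewrite mulr_ge0 ?(ltW rho0) // dotpZl mulr_ge0 ?dotp_ge0 // invr_ge0 l2norm_ge0.
rewrite lerBrDl [(lam p - eta) / 2 * _]mulrAC => /(le_trans _); apply.
by rewrite lerD2r lerDl.
Qed.

Lemma ball_inf_ge p eta : Gamma p -> 0 < eta -> exists2 d, 0 < d &
  forall x rho r, ball p d x -> 0 < rho < d -> r < d ->
  (((lam p - eta) / 2)%:E <= ball_inf asc rho x r)%E.
Proof.
move=> Gp eta0; have [d d0 hd] := asc_ge Gp eta0.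
exists (d / 2); first by rewrite divr_gt0.
move=> x rho r xd /andP[rho0 rhod] rd; apply/ereal_infP => _ [y /= yx <-].
have yd : ball p d y.
  move: xd; rewrite -ball_normE /= => xd.
  rewrite -(subrKA x); apply: le_lt_trans (ler_normD _ _) _.
  by have := norm_le_l2norm (y - x); rewrite distrC; lra.
have rhod' : 0 < rho < d by rewrite rho0; lra.
have r2 : 0 < rho ^- 2 by rewrite invr_gt0 exprn_gt0.
have := hd y rho yd rhod'; rewrite -(@lee_pmul2r _ (rho ^- 2)%:E) //.
by rewrite -EFinM mulfK // gt_eqF // exprn_gt0.
Qed.

Lemma derive_grad_vec (v x : 'rV[R]_D) :
  derivable grad x v /\ 'D_v grad x = v *m H x.
Proof.
have gE j : (fun y => grad y 0 j) = 'D_(delta_mx 0 j) L.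
  by apply/funext => y; rewrite mxE.
have dg : derivable grad x v.
  apply/derivable_mxP => i j; rewrite ord1 gE; apply: diff_derivable.
  by case: C2L => _ /(_ (delta_mx 0 j))[+ _]; apply.
split=> //; rewrite derive_mx //; apply/rowP => j; rewrite mxE gE.
rewrite derive_hessian // dotpE (bigD1 j) //= big1 ?addr0.
  by rewrite [X in _ * X]mxE !eqxx mulr1.
by move=> k kj; rewrite [X in _ * X]mxE (negPf kj) andbF mulr0.
Qed.

(* The gradient at [x + t *: v] is [t * lam x *: v + o(t)], so the ascent
   direction there tends to the eigenvector [v]. *)
Lemma cvg_ascent_direction (x v : 'rV[R]_D) (l : R) : grad x = 0 ->
  0 < l -> l2norm v = 1 -> v *m H x = l *: v ->
  l2unit (grad (t *: v + x)) @[t --> 0^'+] --> v.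
Proof.
move=> gx l0 v1 vH; have [dg Dg] := derive_grad_vec v x.
have lv : l2unit (l *: v) = v by rewrite l2unitZ // /l2unit v1 invr1 scale1r.
have lv0 : l *: v != 0 by rewrite -l2norm_gt0 l2normZ v1 mulr1 normr_gt0 gt_eqF.
have c1 : t^-1 *: (grad (t *: v + x) - grad x) @[t --> (0 : R)^'] --> l *: v.
  by rewrite -vH -Dg; exact: dg.
have c2 := cvg_dnbhs_at_right c1.
have c3 := cvg_comp _ _ c2 (l2unit_continuous lv0).
(* Since [grad x = 0], the difference quotient is a positive multiple of the gradient, and [l2unit]
   ignores positive factors. *)
rewrite lv in c3; apply: cvg_trans c3; apply: near_eq_cvg.
near=> t; rewrite /= gx subr0 l2unitZ // invr_gt0.
by near: t; exact: nbhs_right_gt.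
Unshelve. all: by end_near. Qed.

(** For a unit eigenvector [v] for [lam x], the sharpness at [x + t *: v] tends to
    [L (x + rho *: v) - L x] as [t] tends to 0 from the right, and Taylor's bound controls this
    limit. Any small [t <= r] then serves, so [d] depends neither on [x] nor on [r]. *)
Lemma ball_inf_le p eta : Gamma p -> 0 < eta -> exists2 d, 0 < d &
  forall x rho r, Gamma x -> ball p d x -> 0 < rho < d -> 0 < r ->
  (ball_inf asc rho x r <= ((lam x + eta) / 2)%:E)%E.
Proof.
move=> Gp eta0; have eta4 : 0 < eta / 4 by rewrite divr_gt0.
have /nbhs_ballP[d /= d0 hd] := near_hessian C2L p eta4.
exists (d / 2); first by rewrite divr_gt0.
move=> x rho r Gx xd /andP[rho0 rhod] r0.
have [l0 [v0 v00 v0H] _] := lambda_hessian Gx.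
pose v := l2unit v0.
have vv : dotp v v = 1 by exact: dotp_l2unit.
have v1 : l2norm v = 1 by rewrite l2normE vv sqrtr1.
have vH : v *m H x = lam x *: v.
  by rewrite /v /l2unit -scalemxAl v0H !scalerA mulrC.
have gx : grad x = 0 by apply: grad_local_minimizer => //; exact: minG.
have xd' : `|p - x| < d / 2 by move: xd; rewrite -ball_normE.
have bx : ball p d x by rewrite -ball_normE /=; lra.
have e4 : eta / 4 * dotp v v = eta / 4 by rewrite vv mulr1.
have hdv y : ball p d y ->
    `|dotp (v *m H y) v - dotp (v *m H p) v| <= eta / 4.
  by move=> yb; rewrite -e4; exact: hd.
have qx : dotp (v *m H x) v = lam x by rewrite vH dotpZl vv mulr1.
(* Both forms are compared with the one at [p], each at a cost of [eta / 4]. *)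
have Hv t : 0 <= t <= rho -> dotp (v *m H (x + t *: v)) v <= lam x + eta / 2.
  move=> /andP[t0 tr].
  have yr : ball p d (x + t *: v).
    rewrite -ball_normE /= opprD addrA; apply: le_lt_trans (ler_normB _ _) _.
    rewrite normrZ ger0_norm //.
    have : t * `|v| <= rho * 1 by apply: ler_pM => //; exact: norm_l2unit.
    by lra.
  rewrite -qx; apply: le_trans (ler_dist2 (hdv _ yr) (hdv _ bx)) _.
  by rewrite lerD2l; lra.
(* The slack between [eta / 2] and [eta] makes the inequality strict, so that it passes from the
   limit to small [t]. *)
have Lv : L (x + rho *: v) - L x < (lam x + eta) / 2 * rho ^+ 2.
  have := taylor_le C2L (ltW rho0) Hv; rewrite gx dotpC dotp0l mul0r addr0.
  rewrite -lerBlDl => /le_lt_trans; apply.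
  by rewrite mulrAC ltr_pM2r ?exprn_gt0 // ltr_pM2r ?invr_gt0 // ltrD2l; lra.
have cU := cvg_ascent_direction gx l0 v1 vH.
have cX : t *: v + x @[t --> (0 : R)^'+] --> x.
  rewrite -[X in _ --> X]add0r -(scale0r v); apply: cvgD; last exact: cvg_cst.
  by apply: cvgZr_tmp; apply: cvg_at_right_filter; exact: cvg_id.
have cL : continuous L.
  by move=> y; apply: differentiable_continuous; case: C2L => + _; apply.
have cXU : (t *: v + x) + rho *: l2unit (grad (t *: v + x))
    @[t --> (0 : R)^'+] --> x + rho *: v.
  by apply: cvgD; [exact: cX|apply: cvgZ; [exact: cvg_cst|exact: cU]].
have cG : L ((t *: v + x) + rho *: l2unit (grad (t *: v + x))) - L (t *: v + x)
    @[t --> (0 : R)^'+] --> L (x + rho *: v) - L x.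
  apply: cvgB; first exact: (cvg_comp _ _ cXU (cL _)).
  exact: (cvg_comp _ _ cX (cL x)).
have vn0 : v != 0 by rewrite -l2norm_gt0 v1.
have nG : \forall t \near (0 : R)^'+,
    L ((t *: v + x) + rho *: l2unit (grad (t *: v + x))) - L (t *: v + x) <
    (lam x + eta) / 2 * rho ^+ 2.
  by move/cvgr_lt : cG; apply.
(* A nonzero ascent direction means a nonzero gradient, which excludes the value [+oo]. *)
have nU : \forall t \near (0 : R)^'+, l2unit (grad (t *: v + x)) != 0.
  have /cvgrPdist_lt := cU; move=> /(_ `|v|); rewrite normr_gt0 => /(_ vn0).
  apply: filterS => t; apply: contraPN => /eqP ->; rewrite subr0 ltxx.
  by [].
have [t [[[tG tU] t0] tr]] := filter_ex (filterI (filterI (filterI nG nU)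
  (nbhs_right_gt (0 : R))) (nbhs_right_le r0)).
apply: ge_ereal_inf; exists (asc rho (t *: v + x) * (rho ^- 2)%:E)%E.
  by exists (t *: v + x) => //=; rewrite addrK l2normZ v1 mulr1 gtr0_norm.
have gt0 : grad (t *: v + x) == 0 = false.
  by apply: contraNF tU => /eqP ->; rewrite /l2unit scaler0.
rewrite /asc_sharpness gt0 -EFinM lee_fin ler_pdivrMr ?exprn_gt0 //.
exact: ltW.
Qed.

(** The lower bound is first obtained with [lam p], and continuity of the eigenvalue on [Gamma]
    replaces it by [lam x]. One [d] serves all [x] near [p], as the compactness argument for
    goodness requires. *)
Lemma ball_inf_bounds p e : Gamma p -> 0 < e -> exists2 d, 0 < d &
  forall x rho r, Gamma x -> ball p d x -> 0 < rho < d -> 0 < r < d ->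
  ((lam x / 2 - e)%:E <= ball_inf asc rho x r <= (lam x / 2 + e)%:E)%E.
Proof.
move=> Gp e0; have [d1 d10 h1] := ball_inf_ge Gp e0.
have [d2 d20 h2] := ball_inf_le Gp e0.
have /nbhs_ballP[d3 /= d30 h3] := near_lambda Gp e0.
exists (Num.min d1 (Num.min d2 d3)); first by rewrite !lt_min d10 d20.
move=> x rho r Gx; rewrite -ball_normE /= !lt_min.
move=> /and3P[x1 x2 x3] /andP[rho0 /and3P[rho1 rho2 _]] /andP[r0 /and3P[r1 _ _]].
apply/andP; split.
  apply: (@le_trans _ _ ((lam p - e) / 2)%:E).
    by rewrite lee_fin; apply: half_lerB; apply: h3 => //; rewrite -ball_normE.
  by apply: h1 => //; [rewrite -ball_normE|rewrite rho0].
apply: (@le_trans _ _ ((lam x + e) / 2)%:E).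
  by apply: h2 => //; [rewrite -ball_normE|rewrite rho0].
by rewrite lee_fin half_lerD // ltW.
Qed.

Lemma limiting_regularizer_asc :
  limiting_regularizer asc Gamma (fun x => lam x / 2).
Proof.
move=> x Gx; pose f rho r := ball_inf asc rho x r.
(* The infimum does not increase when the ball grows, so the inner limit exists in the extended
   reals. *)
have cf rho : cvg (f rho r @[r --> 0^'+]).
  apply: nonincreasing_at_right_is_cvge; apply: nearW => _ a b _ _ ab.
  apply: ereal_inf_le_tmp => _ [y /= yx <-]; exists y => //=.
  exact: le_trans ab.
exists (fun rho => lim (f rho r @[r --> 0^'+])); first by move=> rho _; exact: cf.
have bounds e : 0 < e -> \forall rho \near 0^'+,
    ((lam x / 2 - e)%:E <= lim (f rho r @[r --> 0^'+]) <= (lam x / 2 + e)%:E)%E.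
  move=> e0; have [d d0 hd] := ball_inf_bounds Gx e0.
  near=> rho; have rhod : 0 < rho < d.
    by apply/andP; split; near: rho; [exact: nbhs_right_gt|exact: nbhs_right_lt].
  have hr : \forall r \near 0^'+,
      ((lam x / 2 - e)%:E <= f rho r <= (lam x / 2 + e)%:E)%E.
    near=> r; apply: hd => //; first exact: ballxx.
    by apply/andP; split; near: r; [exact: nbhs_right_gt|exact: nbhs_right_lt].
  apply/andP; split.
    by apply: lime_ge => //; apply: filterS hr => r /andP[].
  by apply: lime_le => //; apply: filterS hr => r /andP[].
(* The bounds with [e = 1] show that the inner limits are finite for small [rho]; convergence is
   then a statement about reals. *)
apply/fine_cvgP; split.
  apply: filterS (bounds 1 ltr01) => rho.
  by case: (lim _) => [r| |] //; rewrite ?leye_eq ?leeNy_eq ?andbF.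
apply/cvgrPdist_le => e e0; apply: filterS (bounds e e0) => rho /=.
case: (lim _) => [r| |]; rewrite ?leye_eq ?leeNy_eq ?andbF //= !lee_fin.
by case/andP; rewrite lerBlDr => h1 h2; exact: ler_dist_of h2 h1.
Unshelve. all: by end_near. Qed.

(** Some normal coordinate is nonzero at [x], and by continuity it stays so nearby: [Gamma] is
    relatively closed in the chart domain. *)
Let near_notG A (phi : 'rV[R]_D -> 'rV[R]_D) x : open A -> A x -> ~ Gamma x ->
  {for x, continuous phi} -> (forall y, A y ->
    (Gamma y <-> forall i : 'I_D, (D - M <= i)%N -> phi y 0 i = 0)) ->
  \forall y \near x, ~ Gamma y.
Proof.
move=> oA Ax nG cphi flat.
have [i mi phi0] : exists2 i : 'I_D, (D - M <= i)%N & phi x 0 i != 0.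
  apply: contrapT => h; apply: nG; apply/(flat _ Ax) => i mi.
  by apply/eqP; apply: contrapT => /negP ni; apply: h; exists i.
have ci : (fun y => phi y 0 i) @ x --> phi x 0 i.
  exact: (cvg_comp _ _ cphi (@coord_continuous _ _ _ _ _ _)).
have nphi : \forall y \near x, phi y 0 i != 0.
  move/cvgrPdist_lt : ci => /(_ `|phi x 0 i|); rewrite normr_gt0 => /(_ phi0).
  apply: (@filterS _ (nbhs x)) => y; apply: contraPN => /eqP ->.
  by rewrite subr0 ltxx.
apply: (@filterS2 _ (nbhs x) _ A _ _ _ (open_nbhs_nbhs (conj oA Ax)) nphi).
by move=> y Ay ny /(flat _ Ay)/(_ i mi)/eqP; apply/negP.
Qed.

(** One threshold has to serve all of [V], so [V] is taken with compact closure in a chart domain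
    and local thresholds are combined by compactness. A point of the closure outside [Gamma] has a
    neighbourhood that misses [Gamma], where nothing is to be shown. *)
Lemma good_around_asc xs : Gamma xs ->
  good_around asc Gamma (fun x => lam x / 2) xs.
Proof.
move=> Gs; have [l0 _ _] := lambda_hessian Gs; split.
- by rewrite divr_ge0 // ltW.
- apply/cvgrPdist_le => e e0; apply: filterS (near_lambda Gs e0) => x hx Gx.
  rewrite -mulrBl normrM [`|2^-1|]ger0_norm ?invr_ge0 //.
  apply: le_trans (_ : e / 2 <= _); last by lra.
  by rewrite ler_pM2r ?invr_gt0 //; exact: hx.
have [A [B [phi [psi [[oA As oB] [Cphi _ _ _] _ flat]]]]] := subG Gs.
have /nbhs_ballP[d /= d0 dA] := open_nbhs_nbhs (conj oA As).
have d2 : 0 < d / 2 by rewrite divr_gt0.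
exists (ball xs (d / 2)); split; [exact: ball_open|exact: ballxx|move=> C eps C0 eps0].
have KA : closed_ball xs (d / 2) `<=` A.
  by apply: subset_trans dA; apply: closed_ball_subset => //; lra.
pose P rho x := Gamma x ->
  (`|(lam x / 2)%:E - ball_inf asc rho x (C * rho)| < eps%:E)%E.
(* Working with [eps / 2] turns weak bounds into the required strict inequality. *)
have eps2 : 0 < eps / 2 by rewrite divr_gt0.
have : \forall rho \near (0 : R)^'+, closed_ball xs (d / 2) `<=` P rho.
  have /compact_near_coveringP := @rV_closed_ball_compact _ _ xs _ d2; apply => x Kx.
  have [Gx|nGx] := pselect (Gamma x); last first.
    have cphi : {for x, continuous phi}.
      by apply: differentiable_continuous; case: Cphi => + _; apply; exact: KA.
    exists ([set y | ~ Gamma y], setT) => /=.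
      by split; [exact: near_notG oA (KA _ Kx) nGx cphi flat|exact: filterT].
    by move=> [y rho] /= [nGy _] /nGy.
  have [r r0 hr] := ball_inf_bounds Gx eps2.
  exists (ball x r, [set rho | 0 < rho < r /\ 0 < C * rho < r]) => /=.
    split; first exact: nbhsx_ballx.
    have rC : 0 < r / C by rewrite divr_gt0.
    near=> rho; have rho0 : 0 < rho by near: rho; exact: nbhs_right_gt.
    rewrite /= rho0 mulr_gt0 //=; split; near: rho; first exact: nbhs_right_lt.
    by apply: filterS (nbhs_right_lt rC) => t; rewrite ltr_pdivlMr // mulrC.
  move=> [y rho] /= [yr [rho1 rho2]] Gy.
  by apply: (abse_dist_lt (e := eps / 2)); [lra|exact: hr].
move=> /nbhs_ballP [r /= r0 hr].
exists (r / 2); first by rewrite divr_gt0.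
move=> x rho Gx Vx rho0 rhor; apply: (hr rho) => //.
  by rewrite /ball /= sub0r normrN gtr0_norm //; lra.
exact: subset_closed_ball.
Unshelve. all: by end_near. Qed.
End Minimizers.

(** The first-order Taylor term along the ascent direction is nonnegative, and the Hessian forms
    have a common lower bound [- c] on a compact ball containing every segment of length less than 1
    that starts in [B]. *)
Lemma mildly_bounded_below_asc (R : realType) (D : nat) (L : 'rV[R]_D -> R)
    (U : set 'rV[R]_D) : Ck_on 2 [set: 'rV[R]_D] L ->
  mildly_bounded_below (asc_sharpness L) U.
Proof.
move=> C2L B [m0 [_ Bm]] _ _.
pose m := `|m0| + 1; have m1 : 0 < m by rewrite ltr_wpDl.
have {}Bm x : B x -> `|x| <= m.
  by apply: Bm; rewrite /m (le_lt_trans (ler_norm _)) // ltrDl.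
have m2 : 0 < m + 1 by rewrite ltr_wpDl // ltW.
pose P c x := forall w : 'rV[R]_D, - c * dotp w w <= dotp (w *m hessian L x) w.
have : \forall c \near +oo, closed_ball 0 (m + 1) `<=` P c.
  have /compact_near_coveringP : compact (closed_ball (0 : 'rV[R]_D) (m + 1)).
    by apply: rV_closed_ball_compact; rewrite addr_gt0.
  (* [c0] bounds the form at [x], with an extra 1 for its variation on a neighbourhood of [x]. *)
  apply => x _; pose c0 := D%:R ^+ 2 * `|hessian L x| + 1.
  exists ([set y | forall w : 'rV[R]_D,
    `|dotp (w *m hessian L y) w - dotp (w *m hessian L x) w| <= 1 * dotp w w],
    [set c | c0 <= c]).
    split; first exact: near_hessian.
    by apply: nbhs_pinfty_ge; exact: num_real.
  move=> [y c] /= [hy cc] w.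
  have hx : `|dotp (w *m hessian L x) w| <= D%:R ^+ 2 * `|hessian L x| * dotp w w.
    apply: ler_quad => i j.
    by rewrite [leRHS]/Num.Def.normr /= mx_normrE; apply: (le_bigmax _ _ (i, j)).
  exact: lower_of_dist (hy w) hx (ler_wpM2r (dotp_ge0 w) cc).
move=> nc; have [c [hc c0]] := filter_ex (filterI nc (nbhs_pinfty_gt (num_real (0 : R)))).
exists c => //; near=> rho => x Bx.
have rho0 : 0 < rho by near: rho; exact: nbhs_right_gt.
have rho1 : rho < 1 by near: rho; exact: nbhs_right_lt.
rewrite /asc_sharpness; case: ifPn => [_|g0]; first exact: leey.
rewrite lee_fin -/(l2unit (grad L x)); set v := l2unit _.
have v1 : dotp v v = 1 by exact: dotp_l2unit.
have Hv t : 0 <= t <= rho -> - c <= dotp (v *m hessian L (x + t *: v)) v.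
  move=> /andP[t0 tr]; rewrite -[- c]mulr1 -{1}v1; apply: hc.
  rewrite (closed_ballE _ m2) /closed_ball_ /= distrC subr0.
  apply: le_trans (ler_normD _ _) _; apply: lerD; first exact: Bm.
  rewrite normrZ ger0_norm // -[1]mulr1.
  by apply: ler_pM => //; [apply: le_trans tr (ltW rho1)|exact: norm_l2unit].
have := le_taylor C2L (ltW rho0) Hv.
have vg : 0 <= dotp v (grad L x) * rho.
  by rewrite mulr_ge0 ?(ltW rho0) // dotpZl mulr_ge0 ?dotp_ge0 // invr_ge0 l2norm_ge0.
have c2 : - (c * rho ^+ 2) <= - c * rho ^+ 2 / 2.
  have := mulr_ge0 (ltW c0) (sqr_ge0 rho); lra.
rewrite lerBrDl => /(le_trans _); apply; apply: lerD c2.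
by rewrite lerDl.
Unshelve. all: by end_near. Qed.

Theorem theoremE4 (R : realType) (D M : nat) (L : 'rV[R]_D -> R)
    (Gamma : set 'rV[R]_D) (hM1 : (1 <= M)%N) (hMD : (M <= D)%N)
    (hL : Ck_on 4 [set: 'rV[R]_D] L)
    (hGamma : submanifold 2 (D - M)%N Gamma)
    (hmin : forall x, Gamma x -> local_minimizer L x)
    (hrank : forall x, Gamma x -> \rank (hessian L x) = M) :
  good_limiting_regularizer (asc_sharpness L) Gamma
    (fun x => lambda M (hessian L x) / 2) /\
  mildly_bounded_below (asc_sharpness L) (attraction_set L Gamma).
Proof.
have C2L : Ck_on 2 [set: 'rV[R]_D] L := Ck_onW (Ck_onW hL).
split; last exact: mildly_bounded_below_asc.
split; first exact: limiting_regularizer_asc.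
by move=> xs Gxs; exact: good_around_asc.
Qed.
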